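(* For every $n\in\mathbb{N}$ let $P_n^{(1)}(x)$ and $P_n^{(2)}(x)$ be real polynomials (not identically zero) of degree at most $n$. Let their roots be nonpositive and suppose that, as $n\to\infty$, $[\![P_n^{(1)}]\!]_n\to\mu_1$ and $[\![P_n^{(2)}]\!]_n\to\mu_2$ weakly, for some probability measures $\mu_1$ and $\mu_2$ on $[-\infty,0]$ with Cauchy transforms $G_{\mu_1}$ and $G_{\mu_2}$, respectively. Also suppose that the intervals $(\mu_1(\{0\}),1-\mu_1(\{-\infty\}))$ and $(\mu_2(\{0\}),1-\mu_2(\{-\infty\}))$ have a nonempty intersection. Then the weak limit $$[\![P_n^{(1)}\odot_nP_n^{(2)}]\!]_n\to\mu\qquad(n\to\infty)$$ exists as a probability measure $\mu$ on $[-\infty,0]$, and $\mu$ is determined by its Cauchy transform $G_\mu$ by the rule: the inverse of $t\mapsto tG_\mu(t)$ $(t>0)$ is the product of the inverse of $t\mapsto tG_{\mu_1}(t)$ $(t>0)$ and the inverse of $t\mapsto tG_{\mu_2}(t)$ $(t>0)$, the product being taken on the intersection of the two intervals above.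
   Context: Empirical zero distribution: for a polynomial $P\not\equiv0$ with $\deg P\le n$, $$[\![P]\!]_n:=\frac1n\sum_{z\in\mathbb{C}:P(z)=0}\delta_z+\frac{n-\deg P}{n}\delta_\infty,$$ zeros counted with multiplicity; when all roots are nonpositive, $\infty$ is identified with $-\infty$, so $[\![P]\!]_n$ is a probability measure on $[-\infty,0]$, on which weak convergence is understood. Hadamard product: for $P_n^{(i)}(x)=\sum_{k=0}^n a^{(i)}_{k:n}x^k$, $i=1,2$, $[P_n^{(1)}\odot_nP_n^{(2)}](x)=\sum_{k=0}^n a_{k:n}^{(1)}a_{k:n}^{(2)}x^k$. (It is not identically zero for large $n$ under the assumptions; the convergence concerns large $n$.) Cauchy transform: for a probability measure $\mu$ on $[-\infty,0]$, $G_\mu(t)=\int_{(-\infty,0]}\frac{\mu(dz)}{t-z}$. If $\mu(\{0\})+\mu(\{-\infty\})<1$, then $t\mapsto tG_\mu(t)$ is a strictly increasing continuous bijection from $(0,+\infty)$ onto $(\mu(\{0\}),1-\mu(\{-\infty\}))$, and ''inverse'' means the inverse of this bijection. *)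

(* Defs.v *)
From HB Require Import structures.
From mathcomp Require Import all_boot all_order all_algebra.
From mathcomp Require Import complex.
From mathcomp Require Import all_classical all_reals all_analysis.
From mathcomp Require Import measurable_realfun.

Set Implicit Arguments.
Unset Strict Implicit.
Unset Printing Implicit Defensive.

Import Order.TTheory GRing.Theory Num.Theory.
Import numFieldNormedType.Exports.

Local Open Scope classical_set_scope.
Local Open Scope ring_scope.

Definition complex_poly (R : realType) (P : {poly R}) : {poly R[i]} :=
  map_poly (real_complex R) P.

(* In R[i], [z <= 0] means that z is real and nonpositive. *)
Definition nonpos_rooted (R : realType) (P : {poly R}) : Prop :=
  forall z : R[i], root (complex_poly P) z -> z <= 0.

(* The complex zeros of P != 0, repeated according to multiplicity. *)
Definition zeros (R : realType) (P : {poly R}) : seq R[i] :=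
  sval (closed_field_poly_normal (complex_poly P)).

Definition hadamard (R : realType) (n : nat) (P Q : {poly R}) : {poly R} :=
  \poly_(k < n.+1) (P`_k * Q`_k).

(* Meant for P != 0 with [size P <= n.+1], [0 < n] and [nonpos_rooted P]: the
   zeros are then real, so that Re only transports them from R[i] to R, and the
   missing zeros (those at infinity) are placed at -oo. *)
Definition zero_distr (R : realType) (n : nat) (P : {poly R}) :
    {measure set (\bar R) -> \bar R} :=
  mscale ((n%:R : R)^-1)%:nng
    (measure_add
       (msum (fun k => dirac ((complex.Re (zeros P)`_k)%:E : \bar R))
             (size (zeros P)))
       (msum (fun=> dirac (-oo%E : \bar R)) (n - (size P).-1)%N)).

Definition nonpos_ereal (R : realType) : set (\bar R) := [set x | (x <= 0)%E].

Definition supported_nonpos (R : realType) (mu : probability (\bar R) R) :=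
  mu (@nonpos_ereal R) = 1%E.

(* Continuous functions on the compact space [-oo, 0] are bounded, so these are
   all the test functions of weak convergence. *)
Definition weak_cvg_nonpos (R : realType)
    (nu : nat -> {measure set (\bar R) -> \bar R})
    (mu : {measure set (\bar R) -> \bar R}) : Prop :=
  forall f : \bar R -> R, {within @nonpos_ereal R, continuous f} ->
    \int[nu n]_(x in @nonpos_ereal R) f x @[n --> \oo] -->
    \int[mu]_(x in @nonpos_ereal R) f x.

Definition cauchy (R : realType) (mu : {measure set (\bar R) -> \bar R})
    (t : R) : R :=
  \int[mu]_(z in [set z : \bar R | (-oo < z <= 0)%E]) (t - fine z)^-1.

Definition tcauchy_inv (R : realType) (mu : {measure set (\bar R) -> \bar R}) :
    R -> R :=
  'pinv_(fun=> 0) `]0, +oo[ (fun t => t * cauchy mu t).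

Definition atom_itv (R : realType) (mu : {measure set (\bar R) -> \bar R}) :
    set R :=
  `]fine (mu [set 0%E]), 1 - fine (mu [set -oo%E])[.

(* The inverse of [t * cauchy mu t] has domain [atom_itv mu], which has to be
   the intersection of the domains of the two factors. *)
Definition product_rule (R : realType)
    (mu1 mu2 mu : {measure set (\bar R) -> \bar R}) : Prop :=
  atom_itv mu = atom_itv mu1 `&` atom_itv mu2 /\
  {in atom_itv mu1 `&` atom_itv mu2,
     forall u, tcauchy_inv mu u = tcauchy_inv mu1 u * tcauchy_inv mu2 u}.

(* Main.v *)
From HB Require Import structures.
Require Import Defs.
From mathcomp Require Import all_boot all_order all_algebra.
From mathcomp Require Import complex.
From mathcomp Require Import all_classical all_reals all_analysis.
From mathcomp Require Import measurable_realfun.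
From mathcomp Require Import ring lra zify.

Set Implicit Arguments.
Unset Strict Implicit.
Unset Printing Implicit Defensive.

Import Order.TTheory GRing.Theory Num.Theory.
Import numFieldNormedType.Exports.

Local Open Scope classical_set_scope.
Local Open Scope ring_scope.

(** Write t G(t) for the function whose inverse enters the product rule. Under
    y = 1 / (1 - z), which maps [-oo, 0] onto [0, 1], it is the integral of the
    kernel t y / (1 - y + t y), a continuous function of y; so weak convergence
    of the zero distributions gives t G_n(t) -> t G(t) for every t > 0.

    The point of the proof is a probabilistic reading of t G_n(t). Let P have
    nonpositive zeros -c_i and nonnegative coefficients a_k. The weights
    a_k t^k / P(t) are the law of a sum of independent Bernoulli variables with
    parameters t / (t + c_i), so n t G_n(t) is their mean and their variance is at
    most n / 4. The sequence a_k is also log-concave, hence the law is unimodal, and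
    its mode lies near its mean ([pbpoly_mode_le_mean]). The mode is read off
    the ratios of consecutive coefficients: a_{k-1} <= t a_k holds or fails according
    to whether t G_n(t) is above or below k / n, up to a small error
    ([mean_gt_of_ratio], [mean_lt_of_ratio]). In other words a_{k-1} / a_k is close to
    the inverse of t G_n(t) at k / n. Ratios of consecutive coefficients multiply
    under the Hadamard product, and this is the product rule.

    Reading the estimates in both directions needs the Hadamard product to have
    nonpositive zeros as well ([hadamard_root_le0]). Then s G_1(s) = t G_2(t) = a
    forces (s t) G_n(s t) -> a for the products ([tcauchy_zeros_hadamard_cvg]). Every
    T > 0 splits as s t in this way, by the intermediate value theorem
    ([tcauchy_split]), so T G_n(T) converges for every T > 0.

    It remains to pass from the functions t G(t) back to measures. The constants
    and the kernels t y / (1 - y + t y) span a dense subspace of C[0, 1]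
    ([ckernel_dense]); therefore t G(t) determines the measure
      ([measure_eq_of_tcauchy]), and convergence for all t
    is weak convergence as soon as the limit is known to be of the form
    t G(t) ([unit_mean_cvg_of_ckernel]). The limit measure is obtained by compactness,
    as the law of the limit of the quantile functions along an ultrafilter
    ([limit_measure_exists]). *)

(** * Polynomials with nonpositive zeros *)
Definition prodXD (R : nzRingType) (cs : seq R) : {poly R} :=
  \prod_(c <- cs) ('X + c%:P).

Section ProdXD.
Variable R : idomainType.
Implicit Types (cs : seq R).

Lemma prodXD_cons (c : R) cs : prodXD (c :: cs) = ('X + c%:P) * prodXD cs.
Proof. by rewrite /prodXD big_cons. Qed.

Lemma size_prodXD cs : size (prodXD cs) = (size cs).+1.
Proof.
rewrite /prodXD (eq_bigr (fun c => 'X - (- c)%:P)); last first.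
  by move=> c _; rewrite polyCN opprK.
by rewrite size_prod_XsubC.
Qed.

Lemma prodXD_neq0 cs : prodXD cs != 0.
Proof. by rewrite -size_poly_eq0 size_prodXD. Qed.

Lemma root_prodXD cs x : root (prodXD cs) x = (- x \in cs).
Proof.
elim: cs => [|c cs IH]; first by rewrite /prodXD big_nil rootE hornerC oner_eq0.
rewrite prodXD_cons rootM IH rootE !hornerE inE; congr orb.
by rewrite addrC -(opprK x) subr_eq0 opprK eq_sym.
Qed.

Lemma coef_XD_mul (c : R) (p : {poly R}) k :
  (('X + c%:P) * p)`_k = (if k is j.+1 then p`_j else 0) + c * p`_k.
Proof. by rewrite mulrDl coefD coefXM coefCM; case: k. Qed.

End ProdXD.

Lemma coef_prodXD_ge0 (R : numDomainType) (cs : seq R) k :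
  all (>= 0) cs -> 0 <= (prodXD cs)`_k.
Proof.
elim: cs k => [|c cs IH] k /=; first by rewrite /prodXD big_nil coef1 ler0n.
move=> /andP[c0 cs0]; rewrite prodXD_cons coef_XD_mul addr_ge0//.
  by case: k => // k; exact: IH.
by rewrite mulr_ge0// IH.
Qed.

(** * Hadamard products of polynomials with nonpositive zeros *)
Section UpperHalfPlane.
Variable C : numClosedFieldType.
Implicit Types (F : {poly C}) (rs cs ds : seq C).

Definition upper_rooted F := forall z : C, root F z -> 0 < 'Im z.

Lemma horner_deriv_prod rs (y : C) : y \notin rs ->
  (\prod_(r <- rs) ('X - r%:P))^`().[y] =
  (\prod_(r <- rs) ('X - r%:P)).[y] * \sum_(r <- rs) (y - r)^-1.
Proof.
elim: rs => [|r rs IH]; first by rewrite !big_nil derivC hornerC mulr0.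
rewrite inE negb_or => /andP[yr yrs].
rewrite !big_cons derivM derivXsubC mul1r !hornerE IH //.
set p := _.[y]; set s := \sum_(_ <- _) _.
have yr0 : y - r != 0 by rewrite subr_eq0.
by field.
Qed.

Lemma Im_inv_gt0 (y r : C) : 'Im y <= 0 -> 0 < 'Im r -> 0 < 'Im (y - r)^-1.
Proof.
move=> y0 r0; have im : 'Im (y - r) = 'Im y - 'Im r by rewrite raddfB.
have im0 : 'Im (y - r) < 0 by rewrite im subr_lt0 (le_lt_trans y0).
rewrite ImV divr_gt0 ?oppr_gt0// exprn_gt0// normr_gt0.
by apply: contraTneq im0 => ->; rewrite raddf0 ltxx.
Qed.

(** At a point y of the closed lower half-plane, F'(y) / F(y) is the sum of the
    1 / (y - r) over the zeros r, each with positive imaginary part; it cannot equal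
    the real number -d. *)
Lemma upper_rooted_derivDZ F (d : C) : F != 0 -> 0 < d -> upper_rooted F ->
  F^`() + d *: F != 0 /\ upper_rooted (F^`() + d *: F).
Proof.
move=> F0 d0 upF; have sz : size (F^`() + d *: F) = size F.
  rewrite addrC size_polyDl; rewrite size_scale ?gt_eqF//.
  by rewrite lt_size_deriv.
split=> [|y]; first by rewrite -size_poly_eq0 sz size_poly_eq0.
have [rs defF] := closed_field_poly_normal F.
have rsP r : r \in rs -> 0 < 'Im r.
  move=> rrs; apply: upF; rewrite defF rootZ ?lead_coef_eq0//.
  by rewrite root_prod_XsubC.
apply: contraTT; rewrite -real_leNgt ?rpred0 ?Creal_Im// => y0.
have yrs : y \notin rs by apply: contraTN y0 => /rsP r0; rewrite lt_geF.
have Fy : F.[y] != 0.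
  by rewrite defF -rootE rootZ ?lead_coef_eq0// root_prod_XsubC.
have -> : root (F^`() + d *: F) y = (\sum_(r <- rs) (y - r)^-1 + d == 0).
  rewrite rootE hornerD hornerZ.
  have -> : F^`().[y] = F.[y] * \sum_(r <- rs) (y - r)^-1.
    by rewrite {1}defF derivZ hornerZ horner_deriv_prod// mulrA -hornerZ -defF.
  by rewrite [d * _]mulrC -mulrDr mulf_eq0 (negPf Fy).
case: rs {defF} rsP yrs => [|r rs] rsP yrs.
  by rewrite big_nil add0r gt_eqF.
apply/eqP => /(congr1 (fun z => 'Im z)) /eqP; apply/negP.
rewrite raddfD /= (Creal_ImP _ (gtr0_real d0)) addr0 raddf0 big_cons raddfD /=.
rewrite gt_eqF// ltr_pwDl//; first by rewrite Im_inv_gt0// rsP ?mem_head.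
rewrite raddf_sum big_seq sumr_ge0// => s srs.
by rewrite ltW// Im_inv_gt0// rsP// inE srs orbT.
Qed.

Definition iter_derivDZ ds F := foldr (fun d G => G^`() + d *: G) F ds.

(** The iteration is the differential operator B(d/dy), B being the polynomial whose
    zeros are the opposites of the entries of [ds]. *)
Lemma iter_derivDZE ds F N : (size ds < N)%N ->
  iter_derivDZ ds F = \sum_(k < N) (prodXD ds)`_k *: F^`(k).
Proof.
elim: ds N => [|d ds IH] [//|N] sN.
  rewrite /prodXD big_nil big_ord_recl /= coef1 scale1r big1 ?addr0// => i _.
  by rewrite coef1 scale0r.
rewrite /= (IH N)// prodXD_cons.
rewrite (eq_bigr (fun k : 'I_N.+1 =>
    (if (k : nat) is j.+1 then (prodXD ds)`_j else 0) *: F^`(k)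
    + d *: ((prodXD ds)`_k *: F^`(k)))); last first.
  by move=> i _; rewrite coef_XD_mul scalerDl scalerA.
rewrite big_split /= big_ord_recl scale0r add0r; congr +%R.
  rewrite raddf_sum /=; apply: eq_bigr => i _.
  by rewrite derivZ.
rewrite -scaler_sumr big_ord_recr /=.
by rewrite [(prodXD ds)`_N]nth_default ?size_prodXD // scale0r addr0.
Qed.

Lemma coef_comp_ZX F (x : C) k : (F \Po (x *: 'X))`_k = F`_k * x ^+ k.
Proof.
rewrite comp_polyE coef_sum.
have [kF|Fk] := ltnP k (size F); last first.
  rewrite nth_default// mul0r big1 // => i _.
  rewrite exprZn !coefZ coefXn gtn_eqF ?mulr0//.
  exact: leq_trans (ltn_ord i) Fk.
rewrite (bigD1 (Ordinal kF)) //= exprZn !coefZ coefXn eqxx mulr1 big1 ?addr0//.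
move=> i; rewrite -val_eqE /= => ik.
by rewrite exprZn !coefZ coefXn eq_sym (negPf ik) !mulr0.
Qed.

(** Schur's composition: for fixed x in the upper half-plane the zeros -c / x of
    y |-> A(x y) lie in the upper half-plane, and stay there under B(d/dy); the sum
    below is the value at y = 0 of the resulting polynomial. *)
Lemma schur_upper_neq0 cs ds (x : C) N : (size ds < N)%N ->
  all (> 0) cs -> all (> 0) ds -> 0 < 'Im x ->
  \sum_(k < N) (prodXD cs)`_k * (prodXD ds)`_k * x ^+ k *+ k`! != 0.
Proof.
move=> dsN cs0 ds0 x0.
have xn0 : x != 0 by apply: contraTneq x0 => ->; rewrite raddf0 ltxx.
pose F := prodXD cs \Po (x *: 'X).
have F0 : F != 0.
  rewrite comp_poly_eq0 ?prodXD_neq0// size_scale// size_polyX//.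
have upF : upper_rooted F.
  move=> y; rewrite root_comp root_prodXD !hornerE => /(allP cs0) xy0.
  have -> : y = (- (x * y)) * - x^-1 by field.
  rewrite ImMl ?gtr0_real// mulr_gt0// raddfN /= ImV mulNr opprK.
  by rewrite divr_gt0// exprn_gt0// normr_gt0.
have [G0 upG] : iter_derivDZ ds F != 0 /\ upper_rooted (iter_derivDZ ds F).
  elim: ds ds0 {dsN} => [//|d ds IH] /= /andP[d0 /IH[G0 upG]].
  exact: upper_rooted_derivDZ.
have : ~~ root (iter_derivDZ ds F) 0.
  by apply/negP => /upG; rewrite raddf0 ltxx.
rewrite rootE (iter_derivDZE _ dsN) horner_sum; congr (_ != 0).
apply: eq_bigr => k _; rewrite hornerZ horner_coef0 coef_derivn addn0 ffactnn coef_comp_ZX.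
by rewrite mulrnAr mulrA [_`_k * _ in RHS]mulrC.
Qed.

(** Conjugation moves any nonreal zero to the upper half-plane, and a polynomial with
    nonnegative coefficients has no positive zero. *)
Lemma nonneg_root_le0 F (z : C) : (forall k, 0 <= F`_k) -> F != 0 ->
  (forall x : C, 0 < 'Im x -> F.[x] != 0) -> root F z -> z <= 0.
Proof.
move=> F0 Fn0 upF /eqP Fz.
have imz : 'Im z = 0.
  have le0 (x : C) : F.[x] = 0 -> 'Im x <= 0.
    move=> Fx; rewrite real_leNgt ?rpred0 ?Creal_Im//.
    by apply/negP => /upF; rewrite Fx eqxx.
  apply/eqP; rewrite eq_le le0//= -oppr_le0 -Im_conj le0//.
  transitivity ((F.[z])^*); last by rewrite Fz rmorph0.
  rewrite !horner_coef rmorph_sum; apply: eq_bigr => i _.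
  by rewrite rmorphM rmorphXn /= (conj_Creal (ger0_real (F0 i))).
have zR : z \is Num.real by apply/Creal_ImP.
rewrite real_leNgt ?rpred0//; apply/negP => z0.
suff : 0 < F.[z] by rewrite Fz ltxx.
rewrite horner_coef lt_neqAle sumr_ge0 ?andbT; last first.
  by move=> i _; rewrite mulr_ge0// exprn_ge0// ltW.
apply: contra Fn0; rewrite eq_sym psumr_eq0; last first.
  by move=> i _; rewrite mulr_ge0// exprn_ge0// ltW.
move=> /allP F_0; apply/eqP/polyP => k; rewrite coef0.
have [kF|Fk] := ltnP k (size F); last by rewrite nth_default.
have := F_0 (Ordinal kF) (mem_index_enum _).
by rewrite mulf_eq0 expf_eq0 (gt_eqF z0) andbF orbF => /eqP.
Qed.

Lemma coef0_prodXD_gt0 cs : all (> 0) cs -> 0 < (prodXD cs)`_0.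
Proof.
elim: cs => [|c cs IH] /=; first by rewrite /prodXD big_nil coef1 ltr01.
by move=> /andP[c0 /IH cs0]; rewrite prodXD_cons coef_XD_mul add0r mulr_gt0.
Qed.

Lemma nonneg_prodXD F : (forall k, 0 <= F`_k) -> 0 < F`_0 ->
  (forall x : C, 0 < 'Im x -> F.[x] != 0) ->
  exists (l : C) cs, [/\ 0 < l, all (> 0) cs & F = l *: prodXD cs].
Proof.
move=> Fge0 F0 upF.
have Fn0 : F != 0 by apply: contraTneq F0 => ->; rewrite coef0 ltxx.
have [rs defF] := closed_field_poly_normal F.
exists (lead_coef F), [seq - r | r <- rs]; split.
- by rewrite lt_def lead_coef_eq0 Fn0 lead_coefE Fge0.
- apply/allP => _ /mapP[r rrs ->]; rewrite oppr_gt0 lt_neqAle.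
  have Fr : root F r.
    by rewrite defF rootZ ?lead_coef_eq0// root_prod_XsubC.
  rewrite (nonneg_root_le0 Fge0 Fn0 upF Fr) andbT.
  by apply: contraTneq F0 => r0; rewrite -horner_coef0 -{2}r0 (eqP Fr) ltxx.
- rewrite [LHS]defF /prodXD big_map; congr (_ *: _).
  by apply: eq_bigr => r _; rewrite polyCN.
Qed.

(** Reversing the coefficients inverts the zeros. *)
Lemma coef_prodXD_inv cs k : all (> 0) cs -> (k <= size cs)%N ->
  (prodXD cs)`_(size cs - k) =
  (\prod_(c <- cs) c) * (prodXD [seq c^-1 | c <- cs])`_k.
Proof.
elim: cs k => [|c cs IH] k /=.
  by rewrite leqn0 => _ /eqP->; rewrite /prodXD !big_nil coef1 mulr1.
move=> /andP[c0 cs0] kn; rewrite !prodXD_cons !coef_XD_mul big_cons.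
have cn0 : c != 0 by rewrite gt_eqF.
case: k kn => [_|k kn].
  rewrite subn0 [(prodXD cs)`_(size cs).+1]nth_default ?size_prodXD// mulr0 addr0.
  have := IH 0%N cs0 (leq0n _); rewrite subn0 => ->.
  by rewrite add0r; field.
rewrite subSS; move: kn; rewrite ltnS leq_eqVlt => /predU1P[->|kn].
  rewrite subnn [_`_(size cs).+1]nth_default ?size_prodXD ?size_map//.
  have := IH _ cs0 (leqnn _); rewrite subnn => ->.
  by rewrite mulr0 addr0 add0r mulrA.
rewrite (IH _ cs0 (ltnW kn)); case E : (size cs - k)%N => [|m].
  by move/eqP: E; rewrite subn_eq0 leqNgt kn.
have -> : m = (size cs - k.+1)%N by rewrite subnS E.
by rewrite (IH _ cs0 kn); field.
Qed.

Lemma coef_prodXD_ones n k : (prodXD (nseq n (1 : C)))`_k = 'C(n, k)%:R.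
Proof.
elim: n k => [|n IH] k; first by rewrite /prodXD big_nil coef1; case: k.
rewrite -[nseq _ _]/(1 :: nseq n 1) prodXD_cons coef_XD_mul IH mul1r.
case: k => [|k]; rewrite ?IH.
  by rewrite add0r !bin0.
by rewrite binS natrD addrC.
Qed.

(** Laguerre: dividing the k-th coefficient by k! preserves real-rootedness. Schur's
    composition with (1 + X)^n multiplies the k-th coefficient by n! / (n - k)!, so
    apply it to the reversed polynomial and reverse back. *)
Lemma prodXD_divfact ds : all (> 0) ds ->
  exists (l : C) es, [/\ 0 < l, all (> 0) es, size es = size ds &
    forall k, (prodXD ds)`_k / k`!%:R = l * (prodXD es)`_k].
Proof.
move=> ds0; set n := size ds.
pose ds' := [seq d^-1 | d <- ds].
have ds'0 : all (> 0) ds'.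
  by rewrite all_map; apply: sub_all ds0 => d /=; rewrite invr_gt0.
have sds' : size ds' = n by rewrite size_map.
pose F := \poly_(k < n.+1)
  ((prodXD (nseq n (1 : C)))`_k * (prodXD ds')`_k *+ k`!).
have F_ge0 k : 0 <= F`_k.
  rewrite coef_poly; case: ifP => // _; rewrite mulrn_wge0// mulr_ge0//.
    by rewrite coef_prodXD_ones ler0n.
  by rewrite coef_prodXD_ge0//; apply: sub_all ds'0 => d; exact: ltW.
have [||l [es' [l0 es'0 defF]]] := nonneg_prodXD F_ge0.
- by rewrite coef_poly/= coef_prodXD_ones bin0 mul1r coef0_prodXD_gt0.
- move=> x x0; rewrite horner_poly.
  have := @schur_upper_neq0 (nseq n 1) ds' x n.+1 _ _ ds'0 x0.
  rewrite sds' all_nseq ltr01 orbT => /(_ (ltnSn n) isT).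
  by under eq_bigr do rewrite -mulrnAl.
have ses' : size es' = n.
  apply: succn_inj; rewrite -size_prodXD -(size_scale _ (lt0r_neq0 l0)) -defF.
  rewrite size_poly_eq// coef_prodXD_ones binn mul1r.
  rewrite -mulr_natr mulf_neq0 ?pnatr_eq0 -?lt0n ?fact_gt0//.
  have -> : (prodXD ds')`_n = lead_coef (prodXD ds').
    by rewrite lead_coefE size_prodXD sds'.
  by rewrite lead_coef_eq0 prodXD_neq0.
pose q := \prod_(d <- ds') d; pose q' := \prod_(e <- es') e.
have prod_gt0 (rs : seq C) : all (> 0) rs -> 0 < \prod_(r <- rs) r.
  by elim: rs => [|r rs IH] /=; rewrite ?big_nil// big_cons => /andP[? /IH];
    exact: mulr_gt0.
have q0 : 0 < q by exact: prod_gt0.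
have q'0 : 0 < q' by exact: prod_gt0.
have nf0 m : m`!%:R != 0 :> C by rewrite pnatr_eq0 -lt0n fact_gt0.
exists (l * q' / (n`!%:R * q)), [seq e^-1 | e <- es']; split.
- by rewrite divr_gt0 ?mulr_gt0// ltr0n fact_gt0.
- by rewrite all_map; apply: sub_all es'0 => d /=; rewrite invr_gt0.
- by rewrite size_map.
move=> k; have [kn|nk] := leqP k n; last first.
  by rewrite !nth_default ?mul0r ?mulr0// size_prodXD ?size_map ?ses'.
have := congr1 (fun p : {poly C} => p`_(n - k)) defF.
rewrite coefZ coef_poly ltnS leq_subr coef_prodXD_ones.
have := @coef_prodXD_inv ds' k ds'0; rewrite sds' => /(_ kn) ->.
have := @coef_prodXD_inv es' k es'0; rewrite ses' => /(_ kn) ->.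
rewrite -/q -/q'.
have -> : [seq c^-1 | c <- ds'] = ds.
  by rewrite -map_comp -[RHS]map_id; apply: eq_map => d /=; rewrite invrK.
rewrite bin_sub// -[X in X = _]mulr_natr => E.
have := bin_fact kn => /(congr1 (fun m => m%:R : C)); rewrite !natrM => B.
have b0 : 'C(n, k)%:R != 0 :> C by rewrite pnatr_eq0 -lt0n bin_gt0.
have qn0 := lt0r_neq0 q0.
have E' : l * q' * (prodXD [seq c^-1 | c <- es'])`_k =
  'C(n, k)%:R * (q * (prodXD ds)`_k) * (n - k)`!%:R by rewrite -mulrA -E.
have -> : l * q' / (n`!%:R * q) * (prodXD [seq e^-1 | e <- es'])`_k =
   l * q' * (prodXD [seq e^-1 | e <- es'])`_k / (n`!%:R * q).
  by field; rewrite ?nf0 ?qn0.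
by rewrite E' -B; field; rewrite ?nf0 ?b0 ?qn0.
Qed.

(** Malo: the factor k! of Schur's composition is cancelled by
    [prodXD_divfact]. *)
Lemma hadamard_upper_neq0_gt0 cs ds (x : C) N : (size ds < N)%N ->
  all (> 0) cs -> all (> 0) ds -> 0 < 'Im x ->
  \sum_(k < N) (prodXD cs)`_k * (prodXD ds)`_k * x ^+ k != 0.
Proof.
move=> dsN cs0 /prodXD_divfact[l [es [l0 es0 ses defes]]] x0.
have := @schur_upper_neq0 cs es x N; rewrite ses => /(_ dsN cs0 es0 x0).
rewrite -(mulrI_eq0 _ (mulfI (lt0r_neq0 l0))) mulr_sumr; congr (_ != 0).
apply: eq_bigr => k _.
have -> : (prodXD ds)`_k = l * (prodXD es)`_k * k`!%:R.
  by rewrite -defes mulfVK// pnatr_eq0 -lt0n fact_gt0.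
by rewrite -mulr_natr; ring.
Qed.

Lemma normr_Im_le (z : C) : 'Im z <= `|z|.
Proof.
rewrite (le_trans (real_ler_norm (Creal_Im z)))//.
rewrite -(@ler_pXn2r _ 2)// ?nnegrE// real_normK ?Creal_Im// normC2_Re_Im.
by rewrite lerDr real_exprn_even_ge0// Creal_Re.
Qed.

(** A quantitative form of Hurwitz's theorem. Each zero r has nonpositive imaginary
    part, so |z0 - r| >= 'Im z0 and hence |z - r| <= 2 |z0 - r|. *)
Lemma upper_neq0_growth F (z z0 : C) N : (size F <= N.+1)%N ->
  (forall x : C, 0 < 'Im x -> F.[x] != 0) -> `|z - z0| <= 'Im z0 ->
  `|F.[z]| <= 2 ^+ N * `|F.[z0]|.
Proof.
move=> sF upF zz0; have [->|F0] := eqVneq F 0.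
  by rewrite !horner0 normr0 mulr0.
have [rs defF] := closed_field_poly_normal F.
have rsN : (size rs <= N)%N.
  by move: sF; rewrite defF size_scale ?lead_coef_eq0// size_prod_XsubC.
have key : all (fun r => `|z - r| <= 2 * `|z0 - r|) rs.
  apply/allP => r rrs.
  have Fr : root F r by rewrite defF rootZ ?lead_coef_eq0// root_prod_XsubC.
  have imr : 'Im r <= 0.
    by rewrite real_leNgt ?rpred0 ?Creal_Im//; apply/negP => /upF; rewrite (eqP Fr) eqxx.
  rewrite mulr_natl mulr2n -(subrKA z0) (le_trans (ler_normD _ _))// lerD2r.
  rewrite (le_trans zz0)// (le_trans _ (normr_Im_le _))// raddfB /=.
  by rewrite lerDl oppr_ge0.
rewrite defF !hornerZ !normrM mulrCA ler_wpM2l// !horner_prod !normr_prod.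
apply: (@le_trans _ _ (2 ^+ size rs * \prod_(r <- rs) `|('X - r%:P).[z0]|)).
  elim: rs key {defF rsN} => [|r rs IH] /=; first by rewrite !big_nil mulr1.
  case/andP => kr /IH krs; rewrite !big_cons !hornerXsubC exprS mulrACA.
  by rewrite ler_pM// prodr_ge0.
by rewrite ler_wpM2r ?prodr_ge0// ler_weXn2l// ler1n.
Qed.

Lemma poly_lipschitz0 (p : {poly C}) : exists2 M : C, 0 <= M &
  forall e : C, `|e| <= 1 -> `|p.[e] - p.[0]| <= M * `|e|.
Proof.
elim/poly_ind: p => [|p c [M M0 IH]].
  by exists 0 => // e _; rewrite !horner0 subrr normr0 mul0r.
exists (M + `|p.[0]|) => [|e e1]; first by rewrite addr_ge0.
rewrite !hornerMXaddC mulr0 add0r addrK normrM ler_wpM2r//.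
rewrite -[p.[e]](subrK p.[0]) (le_trans (ler_normD _ _))// lerD2r.
by rewrite (le_trans (IH e e1))// ler_piMr.
Qed.

(** Passage to the limit e -> 0 in a bound between polynomials in e. *)
Lemma norm_limit0 (p q : {poly C}) (K : C) : 0 <= K ->
  (forall e : C, 0 < e -> `|p.[e]| <= K * `|q.[e]|) -> q.[0] = 0 -> p.[0] = 0.
Proof.
move=> K0 pq q0; have [M M0 Mp] := poly_lipschitz0 p.
have [L L0 Lq] := poly_lipschitz0 q.
apply/eqP; rewrite -normr_le0 real_leNgt ?rpred0 ?normr_real//; apply/negP => g0.
set g := `|_| in g0; pose S := M + K * L.
have S0 : 0 <= S by rewrite addr_ge0// mulr_ge0.
have D0 : 0 < g + S + 1 by rewrite ltr_wpDl// addr_ge0// ltW.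
pose e := g / (g + S + 1).
have e0 : 0 < e by rewrite divr_gt0.
have e1 : `|e| <= 1.
  by rewrite gtr0_norm// ler_pdivrMr// mul1r -addrA lerDl addr_ge0.
have : g <= S * e.
  rewrite /g -[X in `|X|](subKr p.[e]) (le_trans (ler_normB _ _))//.
  have := Mp _ e1; have := Lq _ e1; rewrite q0 subr0 (gtr0_norm e0) => Lqe Mpe.
  rewrite addrC mulrDl lerD// -mulrA.
  by rewrite (le_trans (pq _ e0))// ler_wpM2l.
rewrite /e mulrCA ler_pMr// lt_geF//.
by rewrite ltr_pdivrMr// mul1r -addrA addrCA ltrDl addr_gt0.
Qed.

Lemma coef_prodXD_shift cs k : exists p : {poly C}, forall e,
  (prodXD [seq c + e | c <- cs])`_k = p.[e].
Proof.
elim: cs k => [|c cs IH] k.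
  by exists ((k == 0%N)%:R%:P) => e; rewrite /prodXD big_nil coef1 hornerC.
have [p Hp] := IH k; case: k => [|k] in p Hp *.
  exists (('X + c%:P) * p) => e.
  by rewrite prodXD_cons coef_XD_mul Hp !hornerE addrC.
have [q Hq] := IH k; exists (q + ('X + c%:P) * p) => e.
by rewrite prodXD_cons coef_XD_mul Hp Hq !hornerE [e + _]addrC.
Qed.

(** Vanishing entries of [cs] and [ds] are reached by shifting all the entries by
    e > 0. If the limit polynomial vanished at a point z0 of the upper half-plane,
    the growth bound, uniform in e, would make it vanish on a whole segment. *)
Lemma hadamard_root_le0 cs ds N (z : C) : (size ds < N)%N ->
  all (>= 0) cs -> all (>= 0) ds ->
  \poly_(k < N) ((prodXD cs)`_k * (prodXD ds)`_k) != 0 ->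
  root (\poly_(k < N) ((prodXD cs)`_k * (prodXD ds)`_k)) z -> z <= 0.
Proof.
move=> dsN cs0 ds0 F0; apply: nonneg_root_le0 => // [k|z0 imz0].
  by rewrite coef_poly; case: ifP => // _; rewrite mulr_ge0 ?coef_prodXD_ge0.
pose Fe (e : C) := \poly_(k < N) ((prodXD [seq c + e | c <- cs])`_k *
                                  (prodXD [seq d + e | d <- ds])`_k).
have Fe0 : Fe 0 = \poly_(k < N) ((prodXD cs)`_k * (prodXD ds)`_k).
  by rewrite /Fe; do 2!(under eq_map do rewrite addr0; rewrite map_id).
have FeP x : exists p : {poly C}, forall e, (Fe e).[x] = p.[e].
  rewrite /Fe; elim: N {dsN F0 Fe Fe0} => [|N [p Hp]].
    by exists 0 => e; rewrite horner_poly big_ord0 horner0.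
  have [q Hq] := coef_prodXD_shift cs N; have [r Hr] := coef_prodXD_shift ds N.
  exists (p + q * r * (x ^+ N)%:P) => e; rewrite horner_poly big_ord_recr /=.
  by have := Hp e; rewrite horner_poly => ->; rewrite !hornerE Hq Hr.
have [p0 Hp0] := FeP z0.
apply: contraNneq F0 => Fz0; rewrite -Fe0.
have Fz (s : C) : `|s| <= 'Im z0 -> (Fe 0).[z0 + s] = 0.
  move=> sz0; have [p Hp] := FeP (z0 + s); rewrite Hp.
  apply: (@norm_limit0 p p0 (2 ^+ N)); first by rewrite exprn_ge0.
    move=> e e0; rewrite -Hp -Hp0.
    apply: upper_neq0_growth; last by rewrite addrAC subrr add0r.
      by rewrite (leq_trans (size_poly _ _)).
    have shift_gt0 (rs : seq C) : all (>= 0) rs -> all (> 0) [seq r + e | r <- rs].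
      by rewrite all_map; apply: sub_all => r /= r0; rewrite ltr_wpDl.
    move=> x x0; rewrite horner_poly.
    by apply: hadamard_upper_neq0_gt0; rewrite ?size_map ?shift_gt0.
  by rewrite -Hp0 Fe0.
apply/negPn/negP => F1; have := ltnn (size (Fe 0));
  suff -> : (size (Fe 0%R) < size (Fe 0%R))%N by [].
pose rs := [seq z0 + 'Im z0 / j.+1%:R | j <- iota 0 (size (Fe 0))].
have := @max_poly_roots _ (Fe 0) rs F1; rewrite size_map size_iota; apply.
  apply/allP => _ /mapP[j _ ->]; rewrite rootE Fz//.
  have n0 : 0 < j.+1%:R^-1 :> C by rewrite invr_gt0 ltr0Sn.
  rewrite ger0_norm; last by rewrite mulr_ge0 ?ltW.
  rewrite ler_pdivrMr ?ltr0Sn//.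
  by rewrite ler_peMr ?ler1n// ltW.
rewrite map_inj_uniq ?iota_uniq// => i j /addrI /(mulfI (lt0r_neq0 imz0)) /invr_inj.
by move/eqP; rewrite eqr_nat => /eqP[].
Qed.

End UpperHalfPlane.

(** * Sums of independent Bernoulli variables *)
Section PoissonBinomial.
Variable R : archiRealFieldType.
Implicit Types (ps cs ds es : seq R) (f g : nat -> R).

(** The expectation of f(K), where K is a sum of independent Bernoulli variables with
    parameters [ps]; [pbpoly ps] is the generating function of K. *)
Fixpoint pbexp ps f : R :=
  if ps is p :: ps' then p * pbexp ps' (fun k => f k.+1) + (1 - p) * pbexp ps' f
  else f 0%N.

Definition pbpoly ps : {poly R} := \prod_(p <- ps) (p *: 'X + (1 - p)%:P).

Definition is_prob := fun p : R => 0 <= p <= 1.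

Lemma eq_pbexp ps f g : f =1 g -> pbexp ps f = pbexp ps g.
Proof. by elim: ps f g => //= p ps IH f g fg;
  rewrite (IH _ (fun k => g k.+1)) ?(IH f g). Qed.

Lemma pbexpD ps f g : pbexp ps (fun k => f k + g k) = pbexp ps f + pbexp ps g.
Proof.
by elim: ps f g => //= p ps IH f g; rewrite (IH (fun k => f k.+1)) (IH f g); ring.
Qed.

Lemma pbexpZ ps a f : pbexp ps (fun k => a * f k) = a * pbexp ps f.
Proof.
by elim: ps f => //= p ps IH f; rewrite (IH (fun k => f k.+1)) (IH f); ring.
Qed.

Lemma pbexp_cst ps a : pbexp ps (fun=> a) = a.
Proof. by elim: ps => //= p ps ->; ring. Qed.

Lemma le_pbexp ps f g : all is_prob ps ->
  (forall k, (k <= size ps)%N -> f k <= g k) -> pbexp ps f <= pbexp ps g.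
Proof.
elim: ps f g => /= [f g _ -> //|p ps IH f g /andP[/andP[p0 p1] ps01] fg].
by rewrite lerD// ler_wpM2l ?subr_ge0// IH// => k kps; rewrite fg// leqW.
Qed.

Lemma pbexp_sqr ps x : pbexp ps (fun k => (k%:R - x) ^+ 2) =
  \sum_(p <- ps) p * (1 - p) + (\sum_(p <- ps) p - x) ^+ 2.
Proof.
elim: ps x => [|p ps IH] x; first by rewrite !big_nil /=; ring.
rewrite /= (eq_pbexp _ (g := fun k => (k%:R - (x - 1)) ^+ 2)); last first.
  by move=> k; rewrite -natr1; ring.
by rewrite !IH !big_cons; ring.
Qed.

Lemma pbexp_variance ps : all is_prob ps ->
  pbexp ps (fun k => (k%:R - \sum_(p <- ps) p) ^+ 2) <= (size ps)%:R / 4.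
Proof.
rewrite pbexp_sqr subrr expr0n addr0.
elim: ps => [|p ps IH] /=; first by rewrite big_nil mul0r.
move=> /andP[_ /IH {}IH]; rewrite big_cons -natr1.
by have := sqr_ge0 (p - 2^-1); nra.
Qed.

Lemma coef_pbpoly_cons p ps k : (pbpoly (p :: ps))`_k =
  p * (if k is j.+1 then (pbpoly ps)`_j else 0) + (1 - p) * (pbpoly ps)`_k.
Proof.
rewrite /pbpoly big_cons mulrDl coefD coefCM -scalerAl coefZ coefXM.
by case: k.
Qed.

Lemma coef_pbpoly_default ps k : (size ps < k)%N -> (pbpoly ps)`_k = 0.
Proof.
elim: ps k => [|p ps IH] k; first by rewrite /pbpoly big_nil coef1; case: k.
by case: k => // k psk; rewrite coef_pbpoly_cons !IH ?mulr0 ?addr0// ltnW.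
Qed.

Lemma coef_pbpoly_ge0 ps k : all is_prob ps -> 0 <= (pbpoly ps)`_k.
Proof.
elim: ps k => [|p ps IH] k; first by rewrite /pbpoly big_nil coef1 ler0n.
move=> /= /andP[/andP[p0 p1] ps01]; rewrite coef_pbpoly_cons.
rewrite addr_ge0// mulr_ge0 ?subr_ge0 ?IH//.
by case: k => // k; rewrite IH.
Qed.

Lemma pbexpE ps f N : (size ps < N)%N ->
  pbexp ps f = \sum_(k < N) (pbpoly ps)`_k * f k.
Proof.
elim: ps f N => [|p ps IH] f [//|N] /= sN.
  rewrite big_ord_recl /pbpoly big_nil coef1 mul1r big1 ?addr0// => i _.
  by rewrite coef1 mul0r.
rewrite (IH _ N)// (IH _ N.+1); last exact: leqW.
under [in RHS]eq_bigr do rewrite coef_pbpoly_cons mulrDl.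
rewrite big_split /=; congr +%R; last first.
  by rewrite mulr_sumr; apply: eq_bigr => i _; rewrite mulrA.
rewrite big_ord_recl /= mulr0 mul0r add0r mulr_sumr.
by apply: eq_bigr => i _; rewrite mulrA.
Qed.

Lemma coef_pbpoly_rev ps k : (k <= size ps)%N ->
  (pbpoly [seq 1 - p | p <- ps])`_k = (pbpoly ps)`_(size ps - k).
Proof.
elim: ps k => [|p ps IH] k; first by rewrite leqn0 => /eqP->; rewrite /pbpoly !big_nil.
rewrite /= => kn; rewrite !coef_pbpoly_cons opprB addrCA subrr addr0.
case: k kn => [_|k].
  rewrite subn0 [(pbpoly ps)`_(size ps).+1]coef_pbpoly_default//.
  by rewrite IH// subn0; ring.
rewrite ltnS leq_eqVlt subSS => /predU1P[->|kn].
  rewrite IH// subnn [_`_(size ps).+1]coef_pbpoly_default ?size_map//; ring.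
rewrite (IH k (ltnW kn)) (IH k.+1 kn); case E : (size ps - k)%N => [|m].
  by move/eqP: E; rewrite subn_eq0 leqNgt kn.
by have -> : (size ps - k.+1 = m)%N; [rewrite subnS E|ring].
Qed.

(** A weight increasing up to k cannot have its mean much below k. With d = e n, all
    but a mass S of at most n / (4 d^2) lies within d of the mean m (Chebyshev). If
    m <= k - 3 d, each point within d of m weighs at most as much as each of the more
    than d points of [k - d, k], which carry a mass of at most S; so such a point weighs
    at most S / d, and the total mass is at most S + (n + 1) S / d < 1. *)
Lemma pbpoly_mode_le_mean ps (e : R) k : all is_prob ps ->
  (k <= size ps)%N -> 0 < e <= 1 -> 1 <= e ^+ 3 * (size ps)%:R ->
  (forall j, (j < k)%N -> (pbpoly ps)`_j <= (pbpoly ps)`_j.+1) ->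
  k%:R - 3 * e * (size ps)%:R < \sum_(p <- ps) p.
Proof.
move=> ps01 kn /andP[e0 e1] en mono; set n := size ps in kn en *.
set m := \sum_(_ <- _) _; set w := fun j => (pbpoly ps)`_j.
rewrite ltNge; apply/negP => mk.
have w0 j : 0 <= w j by exact: coef_pbpoly_ge0.
have n0 : 0 < n%:R :> R.
  by rewrite ltr0n lt0n; apply: contraTneq en => ->; rewrite mulr0 ler10.
have m0 : 0 <= m.
  by rewrite /m big_seq sumr_ge0// => p /(allP ps01)/andP[].
set d := e * n%:R; have d0 : 0 < d by rewrite mulr_gt0.
have mk' : m <= k%:R - 3 * d by rewrite mulrA.
have wmono i j : (i <= j)%N -> (j <= k)%N -> w i <= w j.
  elim: j => [|j IH]; first by rewrite leqn0 => /eqP->.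
  rewrite leq_eqVlt => /predU1P[->//|ij] jk.
  by rewrite (le_trans (IH ij (ltnW jk)))// mono.
(* T keeps the weights at distance at least d from the mean. *)
pose T j := if d <= `|j%:R - m| then w j else 0.
have T0 j : 0 <= T j by rewrite /T; case: ifP.
pose S := \sum_(0 <= j < n.+1) T j.
have S0 : 0 <= S by rewrite sumr_ge0.
have dS : d ^+ 2 * S <= n%:R / 4.
  apply: le_trans (pbexp_variance ps01).
  rewrite (pbexpE _ (ltnSn _)) /S big_mkord mulr_sumr ler_sum// => j _.
  rewrite -/m /T; case: ifP => [dj|_]; last by rewrite mulr0 mulr_ge0// sqr_ge0.
  rewrite mulrC ler_wpM2l// -[leRHS]real_normK ?num_real//.
  by rewrite ler_pXn2r ?nnegrE// ltW.
pose L := Num.truncn d.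
have /andP[Ld dL] := truncn_itv (ltW d0).
have Lk : (L <= k)%N.
  by rewrite -(ler_nat R) (le_trans Ld)//; lra.
have dw j : (j <= n)%N -> `|j%:R - m| < d -> d * w j <= S.
  move=> jn; rewrite ltr_norml => /andP[_ jd].
  have jk : (j <= k - L)%N.
    by rewrite -(ler_nat R) natrB//; lra.
  rewrite /S (@big_cat_nat _ _ _ (k - L)%N)//=;
    last by rewrite leqW// (leq_trans (leq_subr _ _)).
  rewrite (@big_cat_nat _ _ _ k.+1 (k - L)%N)//=; last by rewrite leqW ?leq_subr.
  rewrite addrCA (@le_trans _ _ (\sum_(k - L <= i < k.+1) w j))//.
    rewrite sumr_const_nat subSn ?leq_subr// subKn// -[leRHS]mulr_natl.
    by rewrite ler_wpM2r// ltW.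
  rewrite -[leLHS]addr0 lerD ?addr_ge0 ?sumr_ge0//.
  rewrite !big_nat ler_sum// => i /andP[ki ik].
  rewrite /T ifT; first by rewrite wmono// (leq_trans jk).
  rewrite (le_trans _ (ler_norm _))//.
  have : k%:R - L%:R <= i%:R :> R by rewrite -natrB// ler_nat.
  by lra.
have sumw : \sum_(0 <= j < n.+1) w j = 1.
  rewrite -[RHS](pbexp_cst ps 1) (pbexpE _ (ltnSn _)) big_mkord.
  by apply: eq_bigr => i _; rewrite mulr1.
have : d <= d * S + n.+1%:R * S.
  have -> : n.+1%:R * S = \sum_(0 <= j < n.+1) S.
    by rewrite sumr_const_nat subn0 mulr_natl.
  rewrite -{1}[d]mulr1 -sumw mulr_sumr.
  rewrite {1}/S mulr_sumr -big_split /= !big_nat ler_sum// => j /andP[_ jn].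
  rewrite /T; case: ifP => [_|]; first by rewrite lerDl.
  by move/negbT; rewrite -ltNge mulr0 add0r => /dw; apply.
have Se : S <= e / 4.
  have dS' : e ^+ 2 * n%:R * S <= 4^-1.
    rewrite -(ler_pM2l n0); move: dS; rewrite /d; nra.
  apply: (@le_trans _ _ (e ^+ 3 * n%:R * S)).
    by rewrite ler_peMl.
  have -> : e ^+ 3 * n%:R * S = e * (e ^+ 2 * n%:R * S) by ring.
  by rewrite ler_pM2l.
rewrite -natr1 => dd.
have n1 : 1 <= n%:R :> R by rewrite ler1n -(ltr_nat R).
have h1 : d * S <= d / 4 by rewrite ler_pM2l//; lra.
have h2 : (n%:R + 1) * S <= d / 2.
  apply: (@le_trans _ _ ((2 * n%:R) * (e / 4))); last by rewrite /d; lra.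
  by rewrite ler_pM//; lra.
by lra.
Qed.

(** The mirror image under k |-> n - k. *)
Lemma pbpoly_mean_lt_mode ps (e : R) k : all is_prob ps ->
  (0 < k <= size ps)%N -> 0 < e <= 1 -> 1 <= e ^+ 3 * (size ps)%:R ->
  (forall j, (k <= j)%N -> (pbpoly ps)`_j <= (pbpoly ps)`_j.-1) ->
  \sum_(p <- ps) p < k%:R + 3 * e * (size ps)%:R.
Proof.
move=> ps01 /andP[k0 kn] e01 en mono; set n := size ps in kn en *.
have qs01 : all is_prob [seq 1 - p | p <- ps].
  rewrite all_map; apply: sub_all ps01 => p /=; rewrite /is_prob; lra.
have kn' : (n.+1 - k <= size [seq (1 - p)%R | p <- ps])%N.
  by rewrite size_map -/n; lia.
have en' : 1 <= e ^+ 3 * (size [seq (1 - p)%R | p <- ps])%:R by rewrite size_map.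
have mono' j : (j < n.+1 - k)%N ->
    (pbpoly [seq (1 - p)%R | p <- ps])`_j <= (pbpoly [seq (1 - p)%R | p <- ps])`_j.+1.
  move=> jk; rewrite !coef_pbpoly_rev -/n; [|lia|lia].
  by rewrite subnS mono//; lia.
have := pbpoly_mode_le_mean qs01 kn' e01 en' mono'.
rewrite size_map big_map sumrB -/n natrB ?(leq_trans kn)// -natr1.
by rewrite big_const_seq count_predT iter_addr_0 -/n; lra.
Qed.

(** * The law attached to the coefficients *)

(** This is t / (t - z) in the coordinate y = 1 / (1 - z), extended to z = -oo
    by the value 0 at y = 0. *)
Definition ckernel (t y : R) : R := t * y / (1 - y + t * y).

Lemma ckernel_den_gt0 (t y : R) : 0 < t -> 0 <= y <= 1 -> 0 < 1 - y + t * y.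
Proof. by move=> t0 /andP[y0 y1]; nra. Qed.

Lemma ckernel_is_prob (t y : R) : 0 < t -> 0 <= y <= 1 -> is_prob (ckernel t y).
Proof.
move=> t0 y01; have d0 := ckernel_den_gt0 t0 y01; case/andP: y01 => y0 y1.
rewrite /is_prob /ckernel divr_ge0 ?mulr_ge0 ?(ltW d0) ?(ltW t0)//=.
by rewrite ler_pdivrMr// mul1r; lra.
Qed.

(** The n zeros in the coordinate y = 1 / (1 - z); the zeros at infinity become 0. *)
Definition unit_zeros (n : nat) cs := [seq (1 + c)^-1 | c <- cs] ++ nseq (n - size cs) 0.

Lemma size_unit_zeros n cs : (size cs <= n)%N -> size (unit_zeros n cs) = n.
Proof. by move=> csn; rewrite size_cat size_map size_nseq subnKC. Qed.

Lemma unit_zeros_prob n cs : all (>= 0) cs -> all is_prob (unit_zeros n cs).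
Proof.
move=> cs0; rewrite all_cat all_map all_nseq /is_prob /= lexx ler01 orbT andbT.
apply: sub_all cs0 => c /= c0.
by rewrite invr_ge0 invf_le1 ?lerDl ?c0 ?addr_ge0// ltr_wpDr.
Qed.

Lemma ckernel0 (t : R) : ckernel t 0 = 0.
Proof. by rewrite /ckernel mulr0 mul0r. Qed.

Lemma ckernel_inv (t c : R) : 0 < t -> 0 <= c -> ckernel t (1 + c)^-1 = t / (t + c).
Proof. by move=> t0 c0; rewrite /ckernel; field; lra. Qed.

(** The coefficients of A, weighted by t^k / A(t), form a Poisson binomial law,
    because (t X + c) / (t + c) = p X + (1 - p) with p = t / (t + c). *)
Lemma coef_prodXD_pbpoly n cs (t : R) k : 0 < t -> all (>= 0) cs ->
  (prodXD cs)`_k * t ^+ k =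
  (prodXD cs).[t] * (pbpoly [seq ckernel t y | y <- unit_zeros n cs])`_k.
Proof.
move=> t0 cs0.
have -> : pbpoly [seq ckernel t y | y <- unit_zeros n cs] =
          pbpoly [seq t / (t + c) | c <- cs].
  rewrite /pbpoly !big_map big_cat /= big_map [X in _ * X]big1_seq ?mulr1.
    by apply: eq_big_seq => c /(allP cs0) c0; rewrite ckernel_inv.
  by move=> y /andP[_]; rewrite mem_nseq => /andP[_ /eqP->];
    rewrite ckernel0 scale0r add0r subr0.
elim: cs k cs0 => [|c cs IH] k /=.
  by rewrite /prodXD /pbpoly !big_nil coef1 hornerC mul1r; case: k => [|k];
    rewrite ?mul1r ?mul0r.
case/andP => c0 cs0; rewrite prodXD_cons coef_XD_mul coef_pbpoly_cons !hornerE.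
have tc : t + c != 0 by rewrite gt_eqF// ltr_wpDr.
set a := (prodXD cs).[t] in IH *; set w := pbpoly _ in IH *.
rewrite mulrDl -[c * _ * _]mulrA (IH k cs0).
have -> : 1 - t / (t + c) = c / (t + c) by field.
case: k => [|k]; first by field.
by rewrite exprSr mulrA (IH k cs0); field.
Qed.

Lemma horner_prodXD_gt0 cs (t : R) : 0 < t -> all (>= 0) cs -> 0 < (prodXD cs).[t].
Proof.
move=> t0; elim: cs => [|c cs IH] /=; first by rewrite /prodXD big_nil hornerC.
by case/andP => c0 /IH; rewrite prodXD_cons !hornerE; apply: mulr_gt0; rewrite ltr_wpDr.
Qed.

Lemma coef_prodXD_gt0 cs k : all (>= 0) cs ->
  (count (pred1 0%R) cs <= k <= size cs)%N -> 0 < (prodXD cs)`_k.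
Proof.
elim: cs k => [|c cs IH] k /=.
  by move=> _; rewrite leqn0 => /eqP->; rewrite /prodXD big_nil coef1.
move=> /andP[c0 cs0] /andP[ck kc]; rewrite prodXD_cons coef_XD_mul.
move: ck; have [cz|cn0] := eqVneq c 0 => ck.
  case: k ck kc => // k; rewrite add1n !ltnS => ck kc.
  by rewrite cz mul0r addr0 IH// ck.
have {c0 cn0} c0 : 0 < c by rewrite lt_def cn0.
move: kc; rewrite leq_eqVlt ltnS => /predU1P[->|kc].
  rewrite ltr_wpDr ?mulr_ge0 ?coef_prodXD_ge0 ?(ltW c0)//.
  by rewrite IH// leqnn count_size.
rewrite ltr_wpDl ?mulr_gt0 ?IH ?ck//.
by clear ck kc; case: k => // k; rewrite coef_prodXD_ge0.
Qed.

(** Log-concavity in a form that also excludes internal zeros. *)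
Lemma prodXD_log_concave cs i j : all (>= 0) cs -> (i <= j)%N ->
  (prodXD cs)`_i * (prodXD cs)`_j.+1 <= (prodXD cs)`_i.+1 * (prodXD cs)`_j.
Proof.
elim: cs i j => [|c cs IH] i j /=.
  by rewrite /prodXD big_nil !coef1 /= mulr0 mul0r.
move=> /andP[c0 cs0]; rewrite leq_eqVlt => /predU1P[->|ij].
  by rewrite mulrC.
rewrite prodXD_cons !coef_XD_mul; set a := polyseq _.
have a0 k : 0 <= a`_k by exact: coef_prodXD_ge0.
case: j ij => // j; rewrite ltnS => ij.
have h1 : a`_i * a`_j.+2 <= a`_i.+1 * a`_j.+1 by rewrite IH// leqW.
have h2 : a`_i * a`_j.+1 <= a`_i.+1 * a`_j by rewrite IH.
have c20 : 0 <= c ^+ 2 by rewrite exprn_ge0.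
case: i ij h1 h2 => [|i] ij h1 h2.
  rewrite add0r.
  have h3 : c * c * (a`_0 * a`_j.+2) <=
    c * c * (a`_1 * a`_j.+1) by rewrite ler_wpM2l ?mulr_ge0.
  have h4 : 0 <= a`_0 * a`_j by rewrite mulr_ge0.
  have h5 : 0 <= c * (a`_1 * a`_j) by rewrite !mulr_ge0.
  by nra.
have h3 : a`_i * a`_j.+1 <= a`_i.+1 * a`_j by rewrite IH// ltnW.
have h4 : a`_i * a`_j.+2 <= a`_i.+1 * a`_j.+1 by rewrite IH// leqW// ltnW.
have h5 : c * c * (a`_i.+1 * a`_j.+2) <=
  c * c * (a`_i.+2 * a`_j.+1) by rewrite ler_wpM2l ?mulr_ge0.
have h6 : c * (a`_i * a`_j.+2) <= c * (a`_i.+2 * a`_j).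
  by rewrite ler_wpM2l// (le_trans h4).
by nra.
Qed.

(** By log-concavity, the comparison of two consecutive weights at k propagates to all
    larger indices, so that the mode is at most k. *)
Lemma mean_lt_of_ratio n cs (t e : R) k : 0 < t -> all (>= 0) cs ->
  (size cs <= n)%N -> (0 < k <= n)%N -> 0 < e <= 1 -> 1 <= e ^+ 3 * n%:R ->
  t * (prodXD cs)`_k <= (prodXD cs)`_k.-1 -> 0 < (prodXD cs)`_k.-1 ->
  \sum_(y <- unit_zeros n cs) ckernel t y < k%:R + 3 * e * n%:R.
Proof.
move=> t0 cs0 csn /andP[k0 kn] e01 en tk ak.
have ps01 : all is_prob [seq ckernel t y | y <- unit_zeros n cs].
  rewrite all_map; apply/allP => y /(allP (unit_zeros_prob n cs0)) y01.
  exact: ckernel_is_prob.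
have := @pbpoly_mean_lt_mode [seq ckernel t y | y <- unit_zeros n cs] e k ps01.
rewrite size_map size_unit_zeros// big_map k0 kn => -> // j kj.
have A0 := horner_prodXD_gt0 t0 cs0.
rewrite -(ler_pM2l A0) -!coef_prodXD_pbpoly//.
have := leq_trans k0 kj; case: j kj => // j kj _ /=.
rewrite exprSr mulrA mulrAC ler_wpM2r ?exprn_ge0 ?(ltW t0)//.
move: kj; rewrite -(prednK k0) ltnS => kj.
rewrite -(ler_pM2l ak); set a := prodXD cs in ak tk *.
have := prodXD_log_concave cs0 kj; rewrite prednK// -/a => h.
have aj := coef_prodXD_ge0 j cs0.
have := ler_wpM2l (ltW t0) h; have := ler_wpM2r aj tk; rewrite -/a; nra.
Qed.

Lemma mean_gt_of_ratio n cs (t e : R) k : 0 < t -> all (>= 0) cs ->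
  (size cs <= n)%N -> (0 < k <= n)%N -> 0 < e <= 1 -> 1 <= e ^+ 3 * n%:R ->
  (prodXD cs)`_k.-1 <= t * (prodXD cs)`_k -> 0 < (prodXD cs)`_k ->
  k%:R - 3 * e * n%:R < \sum_(y <- unit_zeros n cs) ckernel t y.
Proof.
move=> t0 cs0 csn /andP[k0 kn] e01 en tk ak.
have ps01 : all is_prob [seq ckernel t y | y <- unit_zeros n cs].
  rewrite all_map; apply/allP => y /(allP (unit_zeros_prob n cs0)) y01.
  exact: ckernel_is_prob.
have := @pbpoly_mode_le_mean [seq ckernel t y | y <- unit_zeros n cs] e k ps01.
rewrite size_map size_unit_zeros// big_map => -> // j jk.
have A0 := horner_prodXD_gt0 t0 cs0.
rewrite -(ler_pM2l A0) -!coef_prodXD_pbpoly//.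
rewrite exprSr mulrA mulrAC ler_wpM2r ?exprn_ge0 ?(ltW t0)//.
move: jk; rewrite -(prednK k0) ltnS => jk.
rewrite -(ler_pM2r ak); set a := prodXD cs in ak tk *.
have := prodXD_log_concave cs0 jk; rewrite prednK// -/a => h.
have aj := coef_prodXD_ge0 j.+1 cs0.
by have := ler_wpM2l aj tk; rewrite -/a; nra.
Qed.

Lemma sum_ckernel_ys n cs (t : R) : 0 < t -> all (>= 0) cs ->
  \sum_(y <- unit_zeros n cs) ckernel t y = \sum_(c <- cs) t / (t + c).
Proof.
move=> t0 cs0; rewrite big_cat /= big_map [X in _ + X]big1_seq ?addr0.
  by apply: eq_big_seq => c /(allP cs0) c0; rewrite ckernel_inv.
by move=> y /andP[_]; rewrite mem_nseq => /andP[_ /eqP->]; rewrite ckernel0.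
Qed.

(** The mean lies between the number of vanishing entries of [cs] and the size of
    [cs], and between these two bounds all the coefficients are positive. *)
Lemma coef_gt0_of_means n cs (s t : R) k : 0 < s -> 0 < t -> all (>= 0) cs ->
  \sum_(y <- unit_zeros n cs) ckernel s y <= k%:R <=
    \sum_(y <- unit_zeros n cs) ckernel t y ->
  0 < (prodXD cs)`_k.
Proof.
move=> s0 t0 cs0; rewrite !sum_ckernel_ys// => /andP[sk tk].
apply: coef_prodXD_gt0 => //; rewrite -!(ler_nat R); apply/andP; split.
  apply: le_trans sk; rewrite -sum1_count natr_sum big_mkcond /=.
  rewrite !big_seq ler_sum// => c /(allP cs0) /= c0.
  case: eqP => [->|_]; first by rewrite addr0 divff// gt_eqF.
  by rewrite divr_ge0 ?addr_ge0 // ltW.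
apply: (le_trans tk); rewrite -sum1_size natr_sum !big_seq ler_sum// => c.
by move=> /(allP cs0) /= c0; rewrite ler_pdivrMr ?ltr_wpDr// mul1r lerDl.
Qed.

(** Since [es] is the list for the Hadamard product of [cs] and [ds], the inequalities
    a_{k-1} <= s a_k and b_{k-1} <= t b_k multiply. *)
Section Hadamard.
Variables (n : nat) (cs ds es : seq R) (h : R).
Hypotheses (cs0 : all (>= 0) cs) (ds0 : all (>= 0) ds) (es0 : all (>= 0) es).
Hypotheses (csn : (size cs <= n)%N) (dsn : (size ds <= n)%N) (esn : (size es <= n)%N).
Hypothesis h0 : 0 < h.
Hypothesis hadE : forall k, (prodXD cs)`_k * (prodXD ds)`_k = h * (prodXD es)`_k.

Lemma hadamard_mean_gt (s t e : R) k : 0 < s -> 0 < t ->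
  (0 < k <= n)%N -> 0 < e <= 1 -> 1 <= e ^+ 3 * n%:R ->
  0 < (prodXD cs)`_k -> 0 < (prodXD ds)`_k ->
  k%:R + 3 * e * n%:R <= \sum_(y <- unit_zeros n cs) ckernel s y ->
  k%:R + 3 * e * n%:R <= \sum_(y <- unit_zeros n ds) ckernel t y ->
  k%:R - 3 * e * n%:R < \sum_(y <- unit_zeros n es) ckernel (s * t) y.
Proof.
move=> s0 t0 kn e01 en ak bk sk tk.
apply: mean_gt_of_ratio; rewrite ?mulr_gt0//; last first.
  by rewrite -(pmulr_rgt0 _ h0) -hadE mulr_gt0.
rewrite -(ler_pM2l h0) mulrCA -!hadE mulrACA.
apply: ler_pM; rewrite ?coef_prodXD_ge0//.
  rewrite leNgt; apply/negP => lt; move: sk; apply/negP; rewrite -ltNge.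
  apply: mean_lt_of_ratio => //; first exact: ltW.
  by apply: le_lt_trans lt; rewrite mulr_ge0 ?ltW.
rewrite leNgt; apply/negP => lt; move: tk; apply/negP; rewrite -ltNge.
apply: mean_lt_of_ratio => //; first exact: ltW.
by apply: le_lt_trans lt; rewrite mulr_ge0 ?ltW.
Qed.

Lemma hadamard_mean_lt (s t e : R) k : 0 < s -> 0 < t ->
  (0 < k <= n)%N -> 0 < e <= 1 -> 1 <= e ^+ 3 * n%:R ->
  0 < (prodXD cs)`_k.-1 -> 0 < (prodXD ds)`_k.-1 ->
  \sum_(y <- unit_zeros n cs) ckernel s y <= k%:R - 3 * e * n%:R ->
  \sum_(y <- unit_zeros n ds) ckernel t y <= k%:R - 3 * e * n%:R ->
  \sum_(y <- unit_zeros n es) ckernel (s * t) y < k%:R + 3 * e * n%:R.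
Proof.
move=> s0 t0 kn e01 en ak bk sk tk.
apply: mean_lt_of_ratio; rewrite ?mulr_gt0//; last first.
  by rewrite -(pmulr_rgt0 _ h0) -hadE mulr_gt0.
rewrite -(ler_pM2l h0) mulrCA -!hadE mulrACA.
apply: ler_pM; rewrite ?mulr_ge0 ?coef_prodXD_ge0 ?(ltW s0) ?(ltW t0)//.
  rewrite leNgt; apply/negP => lt; move: sk; apply/negP; rewrite -ltNge.
  apply: mean_gt_of_ratio => //; first exact: ltW.
  by rewrite -(pmulr_rgt0 _ s0); apply: lt_trans lt.
rewrite leNgt; apply/negP => lt; move: tk; apply/negP; rewrite -ltNge.
apply: mean_gt_of_ratio => //; first exact: ltW.
by rewrite -(pmulr_rgt0 _ t0); apply: lt_trans lt.
Qed.

End Hadamard.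

End PoissonBinomial.

(** * Density of the kernels in C[0, 1] *)
Section Density.
Variable R : realType.
Implicit Types (g h : R -> R).

Definition cont01 g := {within `[(0 : R), 1], continuous g}.

Lemma cont01_dist g (x e : R) : cont01 g -> 0 <= x <= 1 -> 0 < e ->
  exists2 d : R, 0 < d & forall y : R, 0 <= y <= 1 -> `|x - y| < d -> `|g x - g y| < e.
Proof.
move=> /subspace_continuousP cg x01 e0.
have /cg /cvgrPdist_lt /(_ _ e0) : [set` `[(0 : R), 1]] x by rewrite /= in_itv.
rewrite near_withinE => -[d /= d0 dP]; exists d => // y y01 xy.
by apply: dP => //=; rewrite in_itv.
Qed.

Lemma cont01_bounded g : cont01 g ->
  exists2 M : R, 0 <= M & forall y : R, 0 <= y <= 1 -> `|g y| <= M.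
Proof.
move=> cg; have /compact_bounded[M [_ MP]] :=
  continuous_compact cg (@segment_compact R 0 1).
exists (`|M| + 1) => [|y y01]; first by rewrite addr_ge0.
apply: (MP (`|M| + 1)); first by rewrite (le_lt_trans (ler_norm _))// ltrDl.
by exists y => //=; rewrite in_itv.
Qed.

(** Uniform continuity in the form suited to Bernstein's argument, where the squared
    difference becomes a variance. *)
Lemma cont01_quadratic g (e : R) : cont01 g -> 0 < e ->
  exists2 M : R, 0 <= M & forall x y : R, 0 <= x <= 1 -> 0 <= y <= 1 ->
    `|g x - g y| <= e + M * (x - y) ^+ 2.
Proof.
move=> cg e0; have [B B0 gB] := cont01_bounded cg.
have e20 : 0 < e / 2 by rewrite divr_gt0.
have := @segment_compact R 0 1.
move=> /compact_near_coveringP /near_covering_withinP.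
move=> /(_ _ (pinfty_nbhs R) (fun M x => forall y : R, 0 <= y <= 1 ->
  `|g x - g y| <= e + M * (x - y) ^+ 2) _)[].
  move=> x; rewrite /= in_itv /= => x01.
  have [d d0 dP] := cont01_dist cg x01 e20.
  have d20 : 0 < d / 2 by rewrite divr_gt0.
  exists (ball x (d / 2), [set M | 8 * B / d ^+ 2 < M]) => /=.
    split; first exact: nbhsx_ballx.
    by apply: nbhs_pinfty_gt; rewrite num_real.
  move=> [x' M] /= [xx' BM]; rewrite in_itv /= => x'01 y y01.
  have M0 : 0 <= M.
    rewrite (le_trans _ (ltW BM))// divr_ge0 ?(exprn_ge0 _ (ltW d0))//.
    by rewrite mulr_ge0.
  rewrite /ball /= in xx'.
  have [xy|xy] := ltP `|x - y| d.
    have h1 := dP _ y01 xy.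
    have h2 : `|g x - g x'| < e / 2 by apply: dP => //; apply: (lt_trans xx'); lra.
    rewrite (@le_trans _ _ e)//; last by rewrite lerDl mulr_ge0// sqr_ge0.
    rewrite -(subrKA (g x)) (le_trans (ler_normD _ _))//.
    by rewrite distrC; lra.
  have h1 : d / 2 <= `|x' - y|.
    have := ler_normD (x - x') (x' - y); rewrite subrKA; lra.
  have h2 : `|g x' - g y| <= 2 * B.
    by rewrite (le_trans (ler_normB _ _))// mulr2n mulrDl mul1r lerD// gB.
  rewrite (le_trans h2)// (@le_trans _ _ (M * (x' - y) ^+ 2))//; last by rewrite lerDr ltW.
  rewrite -[(x' - y) ^+ 2]real_normK ?num_real//.
  have h3 : (d / 2) ^+ 2 <= `|x' - y| ^+ 2 by rewrite ler_pXn2r ?nnegrE// ltW.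
  rewrite (le_trans _ (ler_wpM2l M0 h3))//.
  move: BM; rewrite ltr_pdivrMr ?exprn_gt0// => BM.
  by rewrite expr_div_n; lra.
move=> M [_ MP]; exists (`|M| + 1); first by rewrite addr_ge0.
move=> x y x01 y01; apply: (MP (`|M| + 1)) => //=.
by rewrite (le_lt_trans (ler_norm _))// ltrDl.
Qed.

Lemma pbexp_nseq_poly N (f : nat -> R) : exists p : {poly R}, forall y,
  pbexp (nseq N y) f = p.[y].
Proof.
elim: N f => [|N IH] f; first by exists (f 0%N)%:P => y; rewrite hornerC.
have [p Hp] := IH (fun k => f k.+1); have [q Hq] := IH f.
by exists ('X * p + (1 - 'X) * q) => y; rewrite /= Hp Hq !hornerE.
Qed.

(** The Bernstein polynomial is the expectation of g(K / N) for K binomial with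
    parameters N and y. *)
Lemma bernstein g (e : R) : cont01 g -> 0 < e -> exists p : {poly R},
  forall y : R, 0 <= y <= 1 -> `|g y - p.[y]| <= e.
Proof.
move=> cg e0; have e20 : 0 < e / 2 by rewrite divr_gt0.
have [M M0 MP] := cont01_quadratic cg e20.
pose N := (Num.truncn (M / (2 * e))).+1.
have N0 : 0 < N%:R :> R by rewrite ltr0n.
have MN : M / (2 * e) < N%:R by apply: truncnS_gt.
have [p Hp] := pbexp_nseq_poly N (fun k => g (k%:R / N%:R)).
exists p => y y01; rewrite -Hp.
have ps01 : all (@is_prob R) (nseq N y) by rewrite all_nseq /is_prob y01 orbT.
have key k : (k <= size (nseq N y))%N ->
    `|g y - g (k%:R / N%:R)| <= e / 2 + M / N%:R ^+ 2 * (k%:R - N%:R * y) ^+ 2.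
  rewrite size_nseq => kN; have k01 : 0 <= (k%:R / N%:R : R) <= 1.
    by rewrite divr_ge0//= ler_pdivrMr// mul1r ler_nat.
  rewrite (le_trans (MP _ _ y01 k01))// lerD2l le_eqVlt; apply/orP; left.
  by apply/eqP; field; rewrite gt_eqF.
have sumy : \sum_(p <- nseq N y) p = N%:R * y.
  by rewrite big_nseq iter_addr_0 mulr_natl.
have bnd : pbexp (nseq N y) (fun k => e / 2 + M / N%:R ^+ 2 * (k%:R - N%:R * y) ^+ 2) <= e.
  rewrite pbexpD pbexp_cst pbexpZ.
  have := pbexp_variance ps01; rewrite sumy size_nseq => V.
  have c0 : 0 <= M / N%:R ^+ 2 by rewrite divr_ge0// exprn_ge0// ltW.
  have := ler_wpM2l c0 V.
  have -> : M / N%:R ^+ 2 * (N%:R / 4) = M / N%:R / 4 by field; rewrite gt_eqF.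
  suff : M / N%:R <= 2 * e by lra.
  by rewrite ler_pdivrMr// -ler_pdivrMl ?mulr_gt0// mulrC ltW.
rewrite ler_norml; apply/andP; split.
  rewrite -subr_ge0 opprK.
  have : pbexp (nseq N y) (fun k => g (k%:R / N%:R)) <=
         pbexp (nseq N y) (fun k => (e / 2 + M / N%:R ^+ 2 * (k%:R - N%:R * y) ^+ 2) + g y).
    by apply: le_pbexp => // k /key; rewrite ler_norml => /andP[]; lra.
  by rewrite pbexpD pbexp_cst; lra.
have : pbexp (nseq N y) (fun k => g y) <=
       pbexp (nseq N y) (fun k =>
         (e / 2 + M / N%:R ^+ 2 * (k%:R - N%:R * y) ^+ 2) + g (k%:R / N%:R)).
  by apply: le_pbexp => // k /key; rewrite ler_norml => /andP[]; lra.
by rewrite pbexpD pbexp_cst; lra.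
Qed.

Lemma cont01_poly (p : {poly R}) : cont01 (fun y => p.[y]).
Proof. by apply: continuous_subspaceT => x; exact: continuous_horner. Qed.

Lemma cont01_cst (a : R) : cont01 (fun=> a).
Proof. by apply: continuous_subspaceT => x; exact: cvg_cst. Qed.

Lemma cont01_lin (a : R) g h : cont01 g -> cont01 h -> cont01 (fun y => a * g y + h y).
Proof.
move=> /subspace_continuousP cg /subspace_continuousP ch.
apply/subspace_continuousP => x x01; apply: cvgD; last exact: ch.
by apply: cvgM; [exact: cvg_cst|exact: cg].
Qed.

Lemma cont01_div g h : cont01 g -> cont01 h ->
  (forall y : R, 0 <= y <= 1 -> h y != 0) -> cont01 (fun y => g y / h y).
Proof.
move=> /subspace_continuousP cg /subspace_continuousP ch h0.
apply/subspace_continuousP => x x01; apply: cvgM; first exact: cg.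
by apply: cvgV; [apply: h0; move: x01; rewrite /= in_itv|exact: ch].
Qed.

Lemma cont01_ckernel (t : R) : 0 < t -> cont01 (ckernel t).
Proof.
move=> t0; apply: cont01_div; last by move=> y /(ckernel_den_gt0 t0)/gt_eqF->.
  have -> : ( *%R t) = (fun y => (t *: 'X : {poly R}).[y]) by apply/funext => y;
    rewrite !hornerE.
  exact: cont01_poly.
have -> : (fun y => 1 - y + t * y) = (fun y => (1 - 'X + t *: 'X : {poly R}).[y]).
  by apply/funext => y; rewrite !hornerE.
exact: cont01_poly.
Qed.

(** Let r K s be the function y |-> y^(K+1) / (1 + s y). Up to a factor, r 0 s is the
    kernel at t = 1 + s. As s tends to 0, r K s tends uniformly to y^(K+1); and
    r (K+1) s is a combination of y^(K+1) and r K s. Induction on K thus yields all the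
    monomials. *)
Lemma ckernel_dense (Acl : (R -> R) -> Prop) :
  Acl (fun=> 1) -> (forall t, 0 < t -> Acl (ckernel t)) ->
  (forall a g h, Acl g -> Acl h -> Acl (fun y => a * g y + h y)) ->
  (forall g, cont01 g ->
     (forall e : R, 0 < e -> exists2 h, Acl h & forall y : R, 0 <= y <= 1 ->
       `|g y - h y| <= e) ->
     Acl g) ->
  forall g, cont01 g -> Acl g.
Proof.
move=> A1 Ak Alin Alim.
have Aext g h : Acl g -> cont01 h -> (forall y : R, 0 <= y <= 1 -> h y = g y) -> Acl h.
  move=> Ag ch hg; apply: Alim => // e e0; exists g => // y y01.
  by rewrite hg// subrr normr0 ltW.
pose r K (s : R) y := y ^+ K.+1 / (1 + s * y).
have den (s y : R) : 0 < s -> 0 <= y <= 1 -> 0 < 1 + s * y.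
  by move=> s0 /andP[y0 _]; rewrite ltr_wpDr// mulr_ge0// ltW.
have cX K : cont01 (fun y => y ^+ K).
  have -> : (fun y : R => y ^+ K) = (fun y => ('X^K : {poly R}).[y]).
    by apply/funext => y; rewrite !hornerE.
  exact: cont01_poly.
have cr K s : 0 < s -> cont01 (r K s).
  move=> s0; apply: cont01_div; [exact: cX| |by move=> y /(den _ _ s0)/gt_eqF->].
  have -> : (fun y => 1 + s * y) = (fun y => (1 + s *: 'X : {poly R}).[y]).
    by apply/funext => y; rewrite !hornerE.
  exact: cont01_poly.
have AX1 K : (forall s, 0 < s -> Acl (r K s)) -> Acl (fun y => y ^+ K.+1).
  move=> Ar; apply: Alim; first exact: cX.
  move=> e e0; exists (r K e); first exact: Ar.
  move=> y y01; have d0 := den e y e0 y01; case/andP: y01 => y0 y1.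
  have -> : y ^+ K.+1 - r K e y = e * (y ^+ K.+2 / (1 + e * y)).
    by rewrite /r [y ^+ K.+2]exprS; field; rewrite gt_eqF.
  have yK : 0 <= y ^+ K.+2 by rewrite exprn_ge0.
  rewrite ger0_norm; last by rewrite mulr_ge0 ?(ltW e0)// divr_ge0// ltW.
  rewrite ger_pMr// ler_pdivrMr// mul1r (@le_trans _ _ 1) ?exprn_ile1//.
  by rewrite lerDl mulr_ge0// ltW.
have A0 : Acl (fun=> 0).
  have -> : (fun=> 0) = (fun y : R => -1 * 1 + 1) :> (R -> R).
    by apply/funext => y; rewrite mulN1r addNr.
  exact: Alin.
have AZ a g : Acl g -> Acl (fun y => a * g y).
  move=> Ag; have -> : (fun y => a * g y) = (fun y => a * g y + 0).
    by apply/funext => y; rewrite addr0.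
  exact: (Alin a g (fun=> 0)).
have Ar k : forall s, 0 < s -> Acl (r k s).
  elim: k => [|k IH] s s0.
    have s10 : 0 < 1 + s by rewrite addr_gt0.
    apply: (Aext (fun y => (1 + s)^-1 * ckernel (1 + s) y)).
    - exact/AZ/Ak.
    - exact: cr.
    - move=> y y01; have d0 := den _ _ s0 y01.
      rewrite /r /ckernel expr1; field; rewrite !gt_eqF//.
      by have := ckernel_den_gt0 s10 y01.
  have As : Acl (fun y => s^-1 * ((-1) * r k s y + y ^+ k.+1)).
    by apply: AZ; apply: Alin; [exact: IH|exact: AX1].
  apply: Aext As _ _; first exact: cr.
  move=> y y01; have d0 := den _ _ s0 y01.
  by rewrite /r [y ^+ k.+2]exprS; field; rewrite !gt_eqF.
have AX k : Acl (fun y => y ^+ k).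
  by case: k => [|k]; [|exact/AX1/Ar].
have Ap (p : {poly R}) : Acl (fun y => p.[y]).
  have AN N : Acl (fun y => \sum_(i < N) p`_i * y ^+ i).
    elim: N => [|N IH].
      by under [X in Acl X]eq_fun do rewrite big_ord0.
    under [X in Acl X]eq_fun do rewrite big_ord_recr /= addrC.
    exact: Alin.
  by under [X in Acl X]eq_fun do rewrite horner_coef.
move=> g cg; apply: Alim => // e e0; have [p pP] := bernstein cg e0.
by exists (fun y => p.[y]).
Qed.

End Density.

(** * The interval [-oo, 0] in the coordinate y = 1 / (1 - z) *)
Section Compactification.
Variable R : realType.
Local Notation D := (@nonpos_ereal R).

(** On [-oo, 0] this is 1 / (1 - z). Written with [contract] it is, up to a shift, the map
    that defines the metric of the extended reals, hence an isometry. *)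
Definition unit_of (z : \bar R) : R := 1 + contract z.
Definition nonpos_of (y : R) : \bar R := expand (y - 1).

Lemma nonpos_ofK (y : R) : 0 <= y <= 1 -> unit_of (nonpos_of y) = y.
Proof.
move=> y01; rewrite /unit_of /nonpos_of expandK; first by rewrite addrC subrK.
by rewrite inE ler_norml; lra.
Qed.

Lemma unit_ofK z : nonpos_of (unit_of z) = z.
Proof. by rewrite /nonpos_of /unit_of addrAC subrr add0r contractK. Qed.

Lemma unit_of_prob z : D z -> 0 <= unit_of z <= 1.
Proof.
rewrite /nonpos_ereal /= /unit_of -le_contract contract0 => c0.
by have := contract_le1 z; rewrite ler_norml => /andP[]; lra.
Qed.

Lemma nonpos_of_nonpos (y : R) : 0 <= y <= 1 -> D (nonpos_of y).
Proof.
move=> /andP[y0 y1]; rewrite /nonpos_ereal /= -(expand0 R) le_expand//; lra.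
Qed.

Lemma unit_of_fin (z : R) : z <= 0 -> unit_of z%:E = (1 - z)^-1.
Proof.
move=> z0; rewrite /unit_of /contract ler0_norm//; field; lra.
Qed.

Lemma unit_of_Ny : unit_of -oo%E = 0.
Proof. by rewrite /unit_of /= subrr. Qed.

Lemma unit_of_0 : unit_of 0%E = 1.
Proof. by rewrite /unit_of contract0 addr0. Qed.

Lemma measurable_nonpos : measurable D.
Proof.
rewrite (_ : D = [set` `]-oo, 0%E]])//; first exact: emeasurable_itv.
Qed.

Lemma ball_unit_of (z : \bar R) e w : ball z e w = (`|unit_of z - unit_of w| < e) :> Prop.
Proof. by rewrite /ball /= /ereal_ball /unit_of opprD addrACA subrr add0r. Qed.

Lemma measurable_unit_of : measurable_fun setT unit_of.
Proof.
apply: (measurability (@RGenCInfty.G R)) => [|/= _ [_] [r] -> <-].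
  exact: RGenCInfty.measurableE.
rewrite setTI.
have [r2|r2] := ltP 2 r.
  rewrite (_ : _ @^-1` _ = set0)//; apply/seteqP; split => z //=.
  rewrite in_itv/= andbT /unit_of.
  by have := contract_le1 z; rewrite ler_norml => /andP[]; lra.
have [r0|r0] := ltP r 0.
  rewrite (_ : _ @^-1` _ = setT)//; apply/seteqP; split => z //= _.
  rewrite in_itv/= andbT /unit_of.
  by have := contract_le1 z; rewrite ler_norml => /andP[]; lra.
rewrite (_ : _ @^-1` _ = [set` `[expand (r - 1), +oo[]); first exact: emeasurable_itv.
apply/seteqP; split => z /=;
  rewrite !in_itv/= !andbT /unit_of le_expandLR ?inE ?ler_norml; lra.
Qed.

Lemma measurable_comp_unit_of (g : R -> R) : cont01 g -> measurable_fun D (g \o unit_of).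
Proof.
move=> cg; apply: (@measurable_comp _ _ _ _ _ _ `[(0:R), 1]%classic) => //.
- by move=> _ [z /unit_of_prob z01 <-]; rewrite /= in_itv.
- exact: subspace_continuous_measurable_fun.
- exact: (measurable_funS measurableT (@subsetT _ _) measurable_unit_of).
Qed.

Lemma cont01_comp_nonpos_of (f : \bar R -> R) :
  {within D, continuous f} -> cont01 (f \o nonpos_of).
Proof.
move=> /subspace_continuousP cf; apply/subspace_continuousP => y.
rewrite /= in_itv/= => y01; apply/cvgrPdist_lt => e e0.
have /cf/cvgrPdist_lt/(_ _ e0) := nonpos_of_nonpos y01.
rewrite !near_withinE => /nbhs_ballP[d /= d0 dP].
apply/nbhs_ballP; exists d => // x; rewrite /ball /= => yx; rewrite in_itv/= => x01.
apply: dP; last exact: nonpos_of_nonpos.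
by rewrite ball_unit_of !nonpos_ofK.
Qed.

Lemma within_comp_unit_of (g : R -> R) :
  cont01 g -> {within D, continuous (g \o unit_of)}.
Proof.
move=> /subspace_continuousP cg; apply/subspace_continuousP => z Dz.
have z01 := unit_of_prob Dz.
apply/cvgrPdist_lt => e e0.
have : [set` `[(0 : R), 1]] (unit_of z) by rewrite /= in_itv.
move=> /cg/cvgrPdist_lt/(_ _ e0).
rewrite !near_withinE => /nbhs_ballP[d /= d0 dP].
apply/nbhs_ballP; exists d => // w; rewrite ball_unit_of => zw Dw.
by apply: dP => //=; rewrite in_itv/= unit_of_prob.
Qed.

End Compactification.

(** * Means of continuous functions *)
Section Mean.
Variable R : realType.
Local Notation D := (@nonpos_ereal R).
Implicit Types (mu : {measure set (\bar R) -> \bar R}) (g h : R -> R).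

Definition unit_mean mu g := \int[mu]_(z in D) g (unit_of z).

Lemma integrable_unit mu g : mu D = 1%E -> cont01 g ->
  mu.-integrable D (EFin \o (g \o @unit_of R)).
Proof.
move=> mu1 cg; apply: measurable_bounded_integrable.
- exact: measurable_nonpos.
- by rewrite mu1 ltry.
- exact: measurable_comp_unit_of.
- have [M M0 MP] := cont01_bounded cg.
  exists M; split; rewrite ?num_real// => x Mx z Dz.
  by rewrite /= (le_trans _ (ltW Mx))// MP// unit_of_prob.
Qed.

Lemma unit_mean_cst mu (a : R) : mu D = 1%E -> unit_mean mu (fun=> a) = a.
Proof.
by move=> mu1; rewrite /unit_mean Rintegral_cst ?mu1 ?mulr1//; exact: measurable_nonpos.
Qed.

Lemma unit_mean_lin mu (a : R) g h : mu D = 1%E -> cont01 g -> cont01 h ->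
  unit_mean mu (fun y => a * g y + h y) = a * unit_mean mu g + unit_mean mu h.
Proof.
move=> mu1 cg ch; have mD := @measurable_nonpos R.
rewrite /unit_mean RintegralD//.
- by rewrite RintegralZl//; exact: integrable_unit.
- have := integrableZl mD a (integrable_unit mu1 cg).
  by apply: eq_integrable.
- exact: integrable_unit.
Qed.

Lemma le_unit_mean mu g h : mu D = 1%E -> cont01 g -> cont01 h ->
  (forall y : R, 0 <= y <= 1 -> g y <= h y) -> unit_mean mu g <= unit_mean mu h.
Proof.
move=> mu1 cg ch gh; apply: le_Rintegral.
- exact: measurable_nonpos.
- exact: integrable_unit.
- exact: integrable_unit.
- by move=> z /unit_of_prob /gh.
Qed.

Lemma unit_mean_dist mu g h (e : R) : mu D = 1%E -> cont01 g -> cont01 h ->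
  (forall y : R, 0 <= y <= 1 -> `|g y - h y| <= e) ->
    `|unit_mean mu g - unit_mean mu h| <= e.
Proof.
move=> mu1 cg ch gh.
have cl (k : R -> R) (b : R) : cont01 k -> cont01 (fun y => 1 * k y + b).
  by move=> ck; apply: cont01_lin => //; exact: cont01_cst.
have sh (k : R -> R) (b : R) : cont01 k ->
  unit_mean mu (fun y => 1 * k y + b) = unit_mean mu k + b.
  move=> ck; rewrite (unit_mean_lin 1 mu1 ck (@cont01_cst R b)) mul1r unit_mean_cst//.
have : unit_mean mu g <= unit_mean mu (fun y => 1 * h y + e).
  by apply: le_unit_mean => //; [exact: cl|move=> y /gh; rewrite ler_norml mul1r; lra].
have : unit_mean mu h <= unit_mean mu (fun y => 1 * g y + e).
  by apply: le_unit_mean => //; [exact: cl|move=> y /gh; rewrite ler_norml mul1r; lra].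
by rewrite !sh// ler_norml; lra.
Qed.

(** The functions whose means converge form a uniformly closed linear space. *)
Lemma unit_mean_cvg_of_ckernel (nu : nat -> {measure set (\bar R) -> \bar R}) mu :
  (\forall n \near \oo, nu n D = 1%E) -> mu D = 1%E ->
  (forall t : R, 0 < t ->
    unit_mean (nu n) (ckernel t) @[n --> \oo] --> unit_mean mu (ckernel t)) ->
  forall g, cont01 g -> unit_mean (nu n) g @[n --> \oo] --> unit_mean mu g.
Proof.
move=> nu1 mu1 kcvg g cg.
suff [] : cont01 g /\ unit_mean (nu n) g @[n --> \oo] --> unit_mean mu g by [].
move: g cg; apply: ckernel_dense.
- split; first exact: cont01_cst.
  rewrite unit_mean_cst//; apply: cvg_near_cst; near=> n.
  by rewrite unit_mean_cst//; near: n.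
- by move=> t t0; split; [exact: cont01_ckernel|exact: kcvg].
- move=> a g h [cg gcvg] [ch hcvg]; split; first exact: cont01_lin.
  rewrite unit_mean_lin//.
  apply: cvg_trans (cvgD (cvgM (cvg_cst a) gcvg) hcvg).
  apply: near_eq_cvg; near=> n; rewrite /= unit_mean_lin//.
  by near: n.
- move=> g cg gP; split=> //; apply/cvgrPdist_lt => e e0.
  have e40 : 0 < e / 4 by rewrite divr_gt0.
  have [h [ch /cvgrPdist_lt/(_ _ e40) hcvg] gh] := gP _ e40.
  near=> n.
  have h1 := unit_mean_dist mu1 cg ch gh.
  have h2 : `|unit_mean (nu n) g - unit_mean (nu n) h| <= e / 4.
    by apply: unit_mean_dist => //; near: n.
  have h3 : `|unit_mean mu h - unit_mean (nu n) h| < e / 4 by near: n.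
  by move: h1 h2 h3; rewrite !ler_norml !ltr_norml; lra.
Unshelve. all: by end_near. Qed.

Lemma weak_cvg_nonpos_unit_mean (nu : nat -> {measure set (\bar R) -> \bar R}) mu :
  weak_cvg_nonpos nu mu <->
  (forall g, cont01 g -> unit_mean (nu n) g @[n --> \oo] --> unit_mean mu g).
Proof.
split=> [wc g cg|gc f cf].
  exact: (wc _ (within_comp_unit_of cg)).
have E m : \int[m]_(x in D) f x = unit_mean m (f \o @nonpos_of R).
  by apply: eq_Rintegral => z _ /=; rewrite unit_ofK.
rewrite E; under eq_fun do rewrite E.
exact/gc/cont01_comp_nonpos_of.
Qed.

Lemma mul_cauchyE mu (t : R) : 0 < t -> mu D = 1%E ->
  t * Defs.cauchy mu t = unit_mean mu (ckernel t).
Proof.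
move=> t0 mu1; set P := [set z : \bar R | (-oo < z <= 0)%E].
have PE z : P z -> ckernel t (unit_of z) = t * (t - fine z)^-1.
  case: z => [z| |]//=; rewrite /P /= ?lee_fin ?ltxx // => /andP[_ z0].
  rewrite unit_of_fin// -[1 - z]/(1 + - z) ckernel_inv ?oppr_ge0//.
have DP : D `&` P = P.
  apply/seteqP; split => [z []//|z Pz]; split => //.
  by case/andP: Pz.
have -> : unit_mean mu (ckernel t) = \int[mu]_(z in P) ckernel t (unit_of z).
  rewrite -[in RHS]DP Rintegral_mkcondr; apply: eq_Rintegral => z.
  rewrite inE patchE => Dz; case: ifPn => // /negP zP.
  case: z Dz zP => [z| |]//= Dz zP; last by rewrite unit_of_Ny ckernel0.
  by exfalso; apply: zP; rewrite inE /P /= ltNyr.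
have mP : measurable P.
  rewrite (_ : P = [set` `]-oo%E, 0%E] ]); first exact: emeasurable_itv.
  by apply/seteqP; split => z /=; rewrite in_itv.
rewrite -RintegralZl//.
  by apply: eq_Rintegral => z; rewrite inE => /PE.
have hint : mu.-integrable P (EFin \o (ckernel t \o @unit_of R)).
  apply: (integrableS (@measurable_nonpos R)) => //;
    last exact/integrable_unit/cont01_ckernel.
  by rewrite -DP; exact: subIsetl.
have := integrableZl mP (t^-1) hint; apply: eq_integrable => // z.
rewrite inE => /PE /= ->; rewrite -EFinM mulrA mulVf ?mul1r// gt_eqF//.
Qed.

End Mean.

(** * The zero distribution of a polynomial *)
Section ZeroDistr.
Variable R : realType.
Local Notation D := (@nonpos_ereal R).
Implicit Types (P : {poly R}).

Definition negzeros P : seq R := [seq - complex.Re z | z <- zeros P].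

Lemma zerosE P : complex_poly P =
  lead_coef (complex_poly P) *: \prod_(z <- zeros P) ('X - z%:P).
Proof. by rewrite /zeros; case: closed_field_poly_normal. Qed.

Lemma complex_poly_neq0 P : P != 0 -> complex_poly P != 0.
Proof. by rewrite /complex_poly map_poly_eq0. Qed.

Lemma nonpos_rooted_zeros P z : P != 0 -> nonpos_rooted P -> z \in zeros P -> z <= 0.
Proof.
move=> P0 rP zP; apply: rP; rewrite zerosE rootZ ?root_prod_XsubC//.
by rewrite lead_coef_eq0 complex_poly_neq0.
Qed.

Lemma negzeros_ge0 P : P != 0 -> nonpos_rooted P -> all (>= 0) (negzeros P).
Proof.
move=> P0 rP; rewrite /negzeros all_map; apply/allP => z /(nonpos_rooted_zeros P0 rP).
by rewrite lecE /= oppr_ge0 => /andP[].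
Qed.

Lemma poly_negzerosE P : P != 0 -> nonpos_rooted P ->
  P = lead_coef P *: prodXD (negzeros P).
Proof.
move=> P0 rP; apply: (map_poly_inj (real_complex R)).
rewrite -/(complex_poly P) zerosE lead_coef_map map_polyZ /=; congr (_ *: _).
rewrite /prodXD rmorph_prod /= big_map;
  apply: eq_big_seq => z /(nonpos_rooted_zeros P0 rP) z0.
rewrite rmorphD /= map_polyX map_polyC /= rmorphN /= polyCN; congr (_ - _%:P).
move: z0; rewrite lecE /= => /andP[/eqP im _]; case: z im => a b /= <- //.
Qed.

Lemma size_negzeros P : P != 0 -> nonpos_rooted P -> size (negzeros P) = (size P).-1.
Proof.
move=> P0 rP; rewrite [in RHS](poly_negzerosE P0 rP) size_scale ?lead_coef_eq0//.
by rewrite size_prodXD.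
Qed.

Lemma size_negzeros_le n P : P != 0 -> nonpos_rooted P ->
  (size P <= n.+1)%N -> (size (negzeros P) <= n)%N.
Proof.
by move=> P0 rP sP; rewrite size_negzeros// -ltnS prednK// lt0n size_poly_eq0.
Qed.

Lemma ge0_integral_zero_distr n P (f : \bar R -> R) :
  P != 0 -> nonpos_rooted P -> measurable_fun D f -> (forall z, D z -> 0 <= f z) ->
  (\int[zero_distr n P]_(z in D) (f z)%:E =
   (n%:R^-1 * (\sum_(c <- negzeros P) f (- c)%:E +
     (n - size (negzeros P))%:R * f -oo%E))%:E)%E.
Proof.
move=> P0 rP mf f0; have mD := @measurable_nonpos R.
have mf' : measurable_fun D (EFin \o f) by exact/measurable_EFinP.
rewrite ge0_integral_mscale//.
rewrite ge0_integral_measure_add//.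
rewrite !ge0_integral_measure_sum//.
rewrite EFinM EFinD; congr (_ * (_ + _))%E.
  rewrite /negzeros big_map -sumEFin (big_nth 0) big_mkord; apply: eq_bigr => i _.
  rewrite integral_dirac// diracE opprK mem_set ?mul1e//.
  have := nonpos_rooted_zeros P0 rP (mem_nth 0 (ltn_ord i)).
  by rewrite lecE /= => /andP[].
rewrite size_negzeros//.
rewrite (eq_bigr (fun=> (f -oo%E)%:E)); last first.
  by move=> i _; rewrite integral_dirac// diracE mem_set ?mul1e// /nonpos_ereal /= leNye.
by rewrite sumEFin big_const_ord iter_addr_0 mulr_natl.
Qed.

Lemma zero_distr_mass n P : (0 < n)%N -> P != 0 -> (size P <= n.+1)%N ->
  nonpos_rooted P -> zero_distr n P D = 1%E.
Proof.
move=> n0 P0 sP rP; have mD := @measurable_nonpos R.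
rewrite -[LHS]mul1e -integral_cst//.
have E := @ge0_integral_zero_distr n P (cst 1) P0 rP.
rewrite [LHS]E//=.
rewrite mulr1 big_const_seq count_predT iter_addr_0 -natrD subnKC.
  by rewrite mulVf ?pnatr_eq0 -?lt0n.
exact: size_negzeros_le.
Qed.

Lemma unit_mean_zero_distr n P (g : R -> R) :
  P != 0 -> (size P <= n.+1)%N -> nonpos_rooted P -> cont01 g ->
  (forall y : R, 0 <= y <= 1 -> 0 <= g y) ->
  unit_mean (zero_distr n P) g = n%:R^-1 * \sum_(y <- unit_zeros n (negzeros P)) g y.
Proof.
move=> P0 sP rP cg g0; rewrite /unit_mean /Rintegral.
rewrite (ge0_integral_zero_distr n P0 rP (f := g \o @unit_of R)).
- congr (_ * _); rewrite /= big_cat /= big_map big_nseq iter_addr_0 unit_of_Ny mulr_natl.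
  congr (_ + _); apply: eq_big_seq => c /(allP (negzeros_ge0 P0 rP)) c0.
  by rewrite unit_of_fin ?opprK// oppr_le0.
- exact: measurable_comp_unit_of.
- by move=> z /unit_of_prob/g0.
Qed.

End ZeroDistr.

(** * Existence of limit measures *)
Section MonotoneRiemann.
Variable R : realType.
Implicit Types (h : R -> R).

Local Notation leb := (@lebesgue_measure R).

Definition left_sum (N : nat) h : R := N%:R^-1 * \sum_(0 <= j < N) h (j%:R / N%:R).

Lemma monotone_integrable h (i : interval R) : {homo h : x y / x <= y} ->
  (forall x, 0 <= h x <= 1) -> (leb [set` i] < +oo)%E ->
  leb.-integrable [set` i] (EFin \o h).
Proof.
move=> hm h01 fi; apply: measurable_bounded_integrable => //.
  exact: nondecreasing_measurable.
exists 1; split; rewrite ?num_real// => x x1 z _ /=.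
by have /andP[? ?] := h01 z; rewrite ger0_norm// (le_trans _ (ltW x1)).
Qed.

(** The bound depends only on the range of the monotone function; this uniformity
    replaces dominated convergence, which fails along ultrafilters. *)
Lemma monotone_left_sum h (N : nat) : (0 < N)%N -> {homo h : x y / x <= y} ->
  (forall x, 0 <= h x <= 1) ->
  `|\int[leb]_(x in `[0, 1]) h x - left_sum N h| <= N%:R^-1.
Proof.
move=> N0 hm h01; have NR : 0 < N%:R :> R by rewrite ltr0n.
have fin (a b : R) b1 b2 : (leb [set` Interval (BSide b1 a) (BSide b2 b)] < +oo)%E.
  by rewrite lebesgue_measure_itv; case: ifP => _ //=; rewrite ?ltry// -EFinB ltry.
have bnd k : N%:R^-1 * \sum_(0 <= j < k) h (j%:R / N%:R) <=
     \int[leb]_(x in `[0, k%:R / N%:R]) h x <=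
     N%:R^-1 * \sum_(0 <= j < k) h (j.+1%:R / N%:R).
  elim: k => [|k /andP[IH1 IH2]].
    rewrite !big_nil mul0r mulr0 set_itv1 /Rintegral integral_set1 ?lexx//.
  pose x : R := k%:R / N%:R; pose y : R := k.+1%:R / N%:R.
  rewrite -/x in IH1 IH2; rewrite -/y.
  have xy : x <= y by rewrite ler_pM2r ?invr_gt0// ler_nat.
  have yx : y - x = N%:R^-1 by rewrite /y /x -natr1; field; rewrite gt_eqF.
  have split : \int[leb]_(z in `[0, y]) h z =
      \int[leb]_(z in `[0, x]) h z + \int[leb]_(z in `]x, y]) h z.
    rewrite -(@Rintegral_itvB _ h (BLeft 0) (BRight y) x) ?bnd_simp//.
    - by rewrite addrC subrK.
    - exact: monotone_integrable.
    - by rewrite divr_ge0.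
  have len c : \int[leb]_(z in `]x, y]) c = c * N%:R^-1.
    have -> : N%:R^-1 = fine (leb `]x, y]); last exact: Rintegral_cst.
    rewrite lebesgue_measure_itv/= lte_fin.
    case: ltP => [_|yx']; first by rewrite -EFinB /= yx.
    by move: yx'; rewrite -subr_le0 yx invr_le0 lt_geF.
  have cint c : leb.-integrable `]x, y] (EFin \o (fun=> c : R)).
    apply: measurable_bounded_integrable => //; first exact: fin.
    exists `|c|; split; rewrite ?num_real// => w cw z _ /=; exact: ltW.
  rewrite !big_nat_recr//= !mulrDr split; apply/andP; split; apply: lerD => //.
    rewrite mulrC -len; apply: le_Rintegral => //.
      exact: monotone_integrable.
    by move=> z /=; rewrite in_itv/= => /andP[/ltW xz _]; exact: hm.
  rewrite mulrC -len; apply: le_Rintegral => //.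
    exact: monotone_integrable.
  by move=> z /=; rewrite in_itv/= => /andP[_ zy]; exact: hm.
have := bnd N; rewrite divff ?gt_eqF// -/(left_sum N h) => /andP[h1 h2].
have tel : N%:R^-1 * \sum_(0 <= j < N) h (j.+1%:R / N%:R) - left_sum N h <= N%:R^-1.
  rewrite /left_sum -mulrBr -sumrB (telescope_sumr (fun j => h (j%:R / N%:R)))//.
  rewrite ger_pMr ?invr_gt0// mul0r divff ?gt_eqF//.
  by have := h01 1; have := h01 0; lra.
by rewrite ler_norml; lra.
Qed.

Lemma left_sum_dist h (N M : nat) : (0 < N)%N -> (0 < M)%N ->
  {homo h : x y / x <= y} -> (forall x, 0 <= h x <= 1) ->
  `|left_sum N h - left_sum M h| <= N%:R^-1 + M%:R^-1.
Proof.
move=> N0 M0 hm h01; have := monotone_left_sum N0 hm h01.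
have := monotone_left_sum M0 hm h01; rewrite !ler_norml; lra.
Qed.

End MonotoneRiemann.

Section Quantile.
Variable R : realType.
Implicit Types (s : seq R).

(** The default value 1 of [nth] keeps this monotone beyond u = 1. *)
Definition quantile s (u : R) : R :=
  nth 1 (sort <=%R s) (Num.truncn ((size s)%:R * u)).

Lemma quantile_prob s u : all (@is_prob R) s -> 0 <= quantile s u <= 1.
Proof.
move=> s01; rewrite /quantile; set i := Num.truncn _.
have [lt|ge] := ltnP i (size (sort <=%R s)); last by rewrite nth_default// ler01 lexx.
have := mem_nth 1 lt; rewrite mem_sort => /(allP s01); exact.
Qed.

Lemma quantile_homo s : all (@is_prob R) s -> {homo quantile s : u v / u <= v}.
Proof.
move=> s01 u v uv; rewrite /quantile.
have ij : (Num.truncn ((size s)%:R * u) <= Num.truncn ((size s)%:R * v))%N.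
  by apply: le_truncn; rewrite ler_wpM2l.
set i := Num.truncn _ in ij *; set j := Num.truncn _ in ij *.
have [lt|ge] := ltnP j (size (sort <=%R s)); last first.
  rewrite [leRHS]nth_default//.
  by have /andP[] := quantile_prob u s01.
apply: (sorted_leq_nth le_trans le_refl) => //; rewrite ?inE//.
  exact: sort_sorted le_total _.
exact: leq_ltn_trans lt.
Qed.

Lemma left_sum_quantile s (g : R -> R) : (0 < size s)%N ->
  left_sum (size s) (g \o quantile s) = (size s)%:R^-1 * \sum_(y <- s) g y.
Proof.
move=> s0; rewrite /left_sum; congr (_ * _).
rewrite -[RHS](perm_big _ (permEl (perm_sort <=%R s))) [RHS](big_nth 1) size_sort.
rewrite !big_nat; apply: eq_bigr => j _.
by rewrite /= /quantile mulrCA divff ?mulr1 ?natrK// pnatr_eq0 -lt0n.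
Qed.

End Quantile.

Section LimitMeasure.
Variable R : realType.
Local Notation D := (@nonpos_ereal R).

Lemma ckernel_homo (t : R) : 0 < t ->
  {in [pred y | 0 <= y <= 1] &, {homo ckernel t : x y / x <= y}}.
Proof.
move=> t0 x y; rewrite !inE => x01 y01 xy.
have dx := ckernel_den_gt0 t0 x01; have dy := ckernel_den_gt0 t0 y01.
rewrite /ckernel ler_pdivrMr// mulrAC ler_pdivlMr//.
rewrite -!mulrA ler_pM2l//; nra.
Qed.

Lemma measurable_nonpos_of_homo (q : R -> R) : {homo q : x y / x <= y} ->
  measurable_fun [set: measurableTypeR R] (@nonpos_of R \o q).
Proof.
move=> qm; apply: (measurability (@ErealGenCInfty.G R)) => [|/= _ [_] [r] -> <-].
  exact: ErealGenCInfty.measurableE.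
apply: measurableI => //; apply: is_interval_measurable => s t/=.
rewrite !in_itv/= !andbT => fs ft u /andP[su ut].
rewrite in_itv/= andbT (le_trans fs)//.
by rewrite /nonpos_of le_expand// lerD2r qm.
Qed.

(** Let q be the pointwise limit of the quantile functions along an ultrafilter finer
    than infinity. The measure is the law of q under the uniform distribution, carried
    back to [-oo, 0]. The kernels are monotone in y, so means of kernels are integrals
    of monotone functions; Riemann sums with a fixed number of points approximate
    them uniformly, and these sums converge along the ultrafilter. *)
Lemma limit_measure_exists (ys : nat -> seq R) (phi : R -> R) :
  (\forall n \near \oo, size (ys n) = n /\ all (@is_prob R) (ys n)) ->
  (forall t, 0 < t ->
     n%:R^-1 * \sum_(y <- ys n) ckernel t y @[n --> \oo] --> phi t) ->
  exists mu : probability (\bar R) R,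
    mu D = 1%E /\ forall t, 0 < t -> unit_mean mu (ckernel t) = phi t.
Proof.
move=> ysP phiP.
have [U [UU ooU]] := @ultraFilterLemma nat \oo _.
have UP : ProperFilter U by exact: ultra_proper.
have q_ex u : exists2 l : R, 0 <= l <= 1 & quantile (ys n) u @[n --> U] --> l.
  have /(_ (quantile (ys n) u @[n --> U]) _)[] := @segment_compact R 0 1.
    apply: ooU; near=> n; rewrite /= in_itv/= quantile_prob//.
    suff [] : size (ys n) = n /\ all (@is_prob R) (ys n) by [].
    by near: n.
  move=> l []; rewrite /= in_itv/= => l01 lcl; exists l => // V Vl /=.
  have [//|UV] := in_ultra_setVsetC ((fun n => quantile (ys n) u) @^-1` V) UU.
  by have [z [nVz Vz]] := lcl (~` V) V UV Vl.
pose q u := projT1 (cid2 (q_ex u)).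
have q01 u : 0 <= q u <= 1 by rewrite /q; case: cid2.
have qP u : quantile (ys n) u @[n --> U] --> q u by rewrite /q; case: cid2.
have qm : {homo q : u v / u <= v}.
  move=> u v uv; apply: (ler_cvg_to (qP u) (qP v)).
  apply: ooU; near=> n; apply: quantile_homo => //.
  suff [] : size (ys n) = n /\ all (@is_prob R) (ys n) by [].
  by near: n.
pose X : measurableTypeR R -> \bar R := @nonpos_of R \o q.
have mX : measurable_fun [set: measurableTypeR R] X by exact: measurable_nonpos_of_homo.
pose mXm := isMeasurableFun.Build _ _ (measurableTypeR R) (\bar R) X mX.
pose X' : {mfun measurableTypeR R >-> \bar R} := HB.pack X mXm.
exists (distribution (uniform_prob (@ltr01 R)) X'); split.
  rewrite /= /distribution /pushforward /=.
  rewrite (_ : X @^-1` D = setT) ?probability_setT//.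
  by apply/seteqP; split => // u _; exact/nonpos_of_nonpos.
move=> t t0; pose G u := ckernel t (q u).
have Gm : {homo G : u v / u <= v}.
  by move=> u v uv; apply: ckernel_homo; rewrite ?inE ?q01 ?qm.
have G01 u : 0 <= G u <= 1 by exact: ckernel_is_prob.
have -> : unit_mean (distribution (uniform_prob (@ltr01 R)) X') (ckernel t) =
    \int[lebesgue_measure]_(u in `[0, 1]) G u.
  rewrite /unit_mean /Rintegral; congr fine.
  have D0 z : D z -> 0 <= ckernel t (unit_of z).
    by move=> /unit_of_prob z01; have /andP[] := ckernel_is_prob t0 z01.
  rewrite ge0_integral_pushforward//; last 3 first.
  - exact: measurable_nonpos.
  - by apply/measurable_EFinP; exact/measurable_comp_unit_of/cont01_ckernel.
  - by move=> z; rewrite inE lee_fin => /D0.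
  rewrite (_ : X @^-1` D = setT); last first.
    by apply/seteqP; split => // u _; exact/nonpos_of_nonpos.
  rewrite (eq_integral (fun u : measurableTypeR R => (G u)%:E)); last first.
    by move=> u _; rewrite /= /X /= nonpos_ofK.
  rewrite integral_uniform; last 2 first.
  - by apply/measurable_EFinP; exact: nondecreasing_measurable.
  - by move=> u; rewrite lee_fin; have /andP[] := G01 u.
  by rewrite subr0 invr1 mul1e.
pose Gn n u := ckernel t (quantile (ys n) u).
have GnU u : Gn n u @[n --> U] --> G u.
  apply/cvgrPdist_lt => e e0.
  have [d d0 dP] := cont01_dist (cont01_ckernel t0) (q01 u) e0.
  have := qP u => /cvgrPdist_lt/(_ _ d0) qd.
  have qn01 : \forall n \near U, 0 <= quantile (ys n) u <= 1.
    apply: ooU; near=> n; apply: quantile_prob.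
    suff [] : size (ys n) = n /\ all (@is_prob R) (ys n) by [].
    by near: n.
  by apply: filterS2 qd qn01 => n qd qn; exact: dP.
have lsU N : left_sum N (Gn n) @[n --> U] --> left_sum N G.
  apply: cvgMr; elim: {1 3}N => [|m IH].
    by rewrite big_nil; under eq_fun do rewrite big_nil; exact: cvg_cst.
  rewrite big_nat_recr//=; under eq_fun do rewrite big_nat_recr//=.
  exact: cvgD.
have phiU : n%:R^-1 * \sum_(y <- ys n) ckernel t y @[n --> U] --> phi t.
  by move=> V /(phiP t t0) /ooU.
have key N : (0 < N)%N ->
  `|\int[lebesgue_measure]_(u in `[0, 1]) G u - phi t| <= 4 * N%:R^-1.
  move=> N0.
  have h1 := monotone_left_sum N0 Gm G01.
  have NR : 0 < N%:R^-1 :> R by rewrite invr_gt0 ltr0n.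
  have NR2 : 0 < N%:R^-1 / 2 :> R by rewrite divr_gt0.
  have h2 : \forall n \near U, size (ys n) = n /\ all (@is_prob R) (ys n) by exact: ooU.
  have h3 : \forall n \near U, (N <= n)%N by apply: ooU; exact: nbhs_infty_ge.
  have /cvgrPdist_lt/(_ _ NR2) h4 := phiU.
  have /cvgrPdist_lt/(_ _ NR2) h5 := lsU N.
  have [n [[[]]]] := filter_ex (filterI (filterI h2 h3) (filterI h4 h5)).
  move=> [sn an] Nn [/= h6 h7].
  have n0 : (0 < n)%N by exact: leq_trans Nn.
  have Gnm : {homo Gn n : u v / u <= v}.
    by move=> u v uv; apply: ckernel_homo; rewrite ?inE ?quantile_prob ?quantile_homo.
  have Gn01 u : 0 <= Gn n u <= 1 by apply: ckernel_is_prob => //; exact: quantile_prob.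
  have h8 := left_sum_dist N0 n0 Gnm Gn01.
  have := left_sum_quantile (ckernel t) (s := ys n); rewrite sn => /(_ n0) h9.
  have h10 : n%:R^-1 <= N%:R^-1 :> R by rewrite lef_pV2 ?posrE ?ltr0n// ler_nat.
  move: h1 h6 h7 h8; rewrite -h9 -[left_sum n (_ \o _)]/(left_sum n (Gn n)).
  by rewrite !ler_norml !ltr_norml; lra.
apply/eqP; rewrite -subr_eq0 -normr_le0 leNgt; apply/negP.
set a := `|_| => a0; pose N := (Num.truncn (4 / a)).+1.
have : 4 / a < N%:R by exact: truncnS_gt.
have := key N isT; rewrite -/a ler_pdivlMr ?ltr0n// ltr_pdivrMr// mulrC; lra.
Unshelve. all: by end_near. Qed.

End LimitMeasure.

(** * The function t G(t) *)
Section CauchyTransform.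
Variable R : realType.
Local Notation D := (@nonpos_ereal R).
Implicit Types (mu nu : {measure set (\bar R) -> \bar R}).

Lemma unit_mean_cvg_indic mu (g_ : nat -> R -> R) (A : set (\bar R)) :
  mu D = 1%E -> measurable A -> (forall n, cont01 (g_ n)) ->
  (forall n (y : R), 0 <= y <= 1 -> `|g_ n y| <= 1) ->
  (forall z, D z -> g_ n (unit_of z) @[n --> \oo] --> (\1_A z : R)) ->
  unit_mean mu (g_ n) @[n --> \oo] --> fine (mu (A `&` D)).
Proof.
move=> mu1 mA cg g1 gA; have mD := @measurable_nonpos R.
have c1 : mu.-integrable D (EFin \o (cst 1 \o @unit_of R)).
  exact: integrable_unit mu1 (@cont01_cst _ 1).
have [] := @dominated_convergence _ _ _ mu D mD (fun n z => (g_ n (unit_of z))%:E)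
  (fun z => (\1_A z)%:E) (fun=> 1%E).
- by move=> n; apply/measurable_EFinP; exact: measurable_comp_unit_of.
- by apply/measurable_EFinP; exact: measurable_indic.
- by apply: aeW => z Dz; apply: cvg_EFin; [exact: nearW|exact: gA].
- exact: c1.
- by apply: aeW => z n Dz; rewrite lee_fin g1// unit_of_prob.
move=> _ _; rewrite integral_indic// => h.
apply: fine_cvg; rewrite fineK//.
rewrite ge0_fin_numE// (@le_lt_trans _ _ 1%E) ?ltry// -mu1.
by apply: le_measure; rewrite ?inE//; exact: measurableI.
Qed.

Section OneMeasure.
Variable mu : {measure set (\bar R) -> \bar R}.
Hypothesis mu1 : mu D = 1%E.

Definition tcauchy (t : R) := unit_mean mu (ckernel t).
Definition atom0 := fine (mu [set 0%E]).
Definition atomN := fine (mu [set -oo%E]).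

Lemma ckernel_sub (s t y : R) : 0 < s -> 0 < t -> 0 <= y <= 1 ->
  ckernel t y - ckernel s y = (t - s) * (y * (1 - y)) / ((1 - y + t * y) * (1 - y + s * y)).
Proof.
move=> s0 t0 y01; have d1 := ckernel_den_gt0 s0 y01; have d2 := ckernel_den_gt0 t0 y01.
by rewrite /ckernel; field; rewrite !gt_eqF.
Qed.

Lemma ckernel_le (s t y : R) : 0 < s -> s <= t -> 0 <= y <= 1 -> ckernel s y <= ckernel t y.
Proof.
move=> s0 st y01; have t0 := lt_le_trans s0 st.
have d1 := ckernel_den_gt0 s0 y01; have d2 := ckernel_den_gt0 t0 y01.
rewrite -subr_ge0 ckernel_sub// divr_ge0// ?mulr_ge0 ?subr_ge0 ?(ltW d1) ?(ltW d2)//; lra.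
Qed.

Lemma tcauchy_le (s t : R) : 0 < s -> s <= t -> tcauchy s <= tcauchy t.
Proof.
move=> s0 st; have t0 := lt_le_trans s0 st.
by apply: le_unit_mean => // [| |y y01];
  [exact: cont01_ckernel|exact: cont01_ckernel|exact: ckernel_le].
Qed.

Lemma tcauchy_dist (s t : R) : 0 < s -> s <= t -> `|tcauchy t - tcauchy s| <= (t - s) / s.
Proof.
move=> s0 st; have t0 := lt_le_trans s0 st.
apply: unit_mean_dist => // [| |y y01]; [exact: cont01_ckernel|exact: cont01_ckernel|].
have d1 := ckernel_den_gt0 s0 y01; have d2 := ckernel_den_gt0 t0 y01.
rewrite ger0_norm ?subr_ge0 ?ckernel_le// ckernel_sub// ler_pdivrMr ?mulr_gt0//.
rewrite -[(t - s) / s * _]mulrA ler_wpM2l ?subr_ge0//.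
rewrite ler_pdivlMl//; case/andP: y01 => y0 y1.
have -> : s * (y * (1 - y)) = (1 - y) * (s * y) by ring.
have sy : 0 <= s * y by rewrite mulr_ge0// ltW.
have ty : 0 <= t * y by rewrite mulr_ge0// ltW.
by apply: ler_pM; lra.
Qed.

Lemma tcauchy_continuous (s : R) : 0 < s -> {for s, continuous tcauchy}.
Proof.
move=> s0; apply/cvgrPdist_le => e e0.
near=> t.
have ts : `|s - t| < s / 2 by near: t; apply: cvgr_dist_lt; rewrite ?divr_gt0.
have ts2 : `|s - t| <= e * (s / 2).
  by near: t; apply: cvgr_dist_le; rewrite ?mulr_gt0 ?divr_gt0.
have t0 : s / 2 < t by move: ts; rewrite ltr_norml; lra.
have s20 : 0 < s / 2 by rewrite divr_gt0.
have [st|/ltW ts'] := leP s t.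
  rewrite distrC (le_trans (tcauchy_dist s0 st))// ler_pdivrMr//.
  by move: ts2; rewrite ler_norml; nra.
have t00 := lt_trans s20 t0.
rewrite (le_trans (tcauchy_dist t00 ts'))// ler_pdivrMr//.
by move: ts2; rewrite ler_norml; nra.
Unshelve. all: by end_near. Qed.

Lemma tcauchy_cvg0 : tcauchy n.+1%:R^-1 @[n --> \oo] --> atom0.
Proof.
have -> : atom0 = fine (mu ([set 0%E] `&` D)).
  by rewrite setIidl// => z ->; rewrite /nonpos_ereal /=.
have n0 n : 0 < n.+1%:R^-1 :> R by rewrite invr_gt0 ltr0n.
apply: unit_mean_cvg_indic => //.
- by move=> n; exact: cont01_ckernel.
- by move=> n y y01; have /andP[k0 k1] := ckernel_is_prob (n0 n) y01; rewrite ger0_norm.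
move=> z Dz; have [->|z0] := eqVneq z 0%E.
  rewrite indicE mem_set//= unit_of_0; apply: cvg_near_cst; apply: nearW => n.
  by rewrite /ckernel subrr add0r mulr1 divff// gt_eqF.
rewrite indicE memNset//=; last by move=> /= z0'; rewrite z0' eqxx in z0.
have z01 := unit_of_prob Dz.
have y1 : unit_of z < 1.
  rewrite lt_neqAle; case/andP: (z01) => _ ->; rewrite andbT.
  apply: contra z0 => /eqP; rewrite -unit_of_0 => /(congr1 (@nonpos_of R)).
  by rewrite !unit_ofK => ->.
set y := unit_of z in z01 y1 *.
have y10 : 0 < 1 - y by rewrite subr_gt0.
have sq : (fun n => n.+1%:R^-1 * (1 - y)^-1) @ \oo --> (0 : R).
  rewrite -[X in _ --> X](mul0r (1 - y)^-1); apply: cvgMl.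
  exact: cvg_harmonic.
apply: (squeeze_cvgr _ (cvg_cst 0) sq); apply: nearW => n.
have /andP[k0 k1] := ckernel_is_prob (n0 n) z01; rewrite k0 /=.
rewrite /ckernel -!mulrA ler_pM2l//.
case/andP: z01 => y0 _.
rewrite ler_pdivrMr; last by rewrite ltr_wpDr// mulr_ge0// ltW.
rewrite mulrDr mulVf ?gt_eqF// (le_trans (ltW y1))// lerDl.
by rewrite mulr_ge0 ?invr_ge0 ?mulr_ge0// ltW.
Qed.

Lemma tcauchy_cvgy : tcauchy n.+1%:R @[n --> \oo] --> 1 - atomN.
Proof.
have mD := @measurable_nonpos R; have mN := @emeasurable_set1 R -oo%E.
have -> : 1 - atomN = fine (mu (~` [set -oo%E] `&` D)).
  have muD : (mu D < +oo)%E by rewrite mu1 ltry.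
  rewrite setIC -setDE measureD//.
  rewrite setIidr; last by move=> z ->; rewrite /nonpos_ereal /= leNye.
  suff fN : mu [set -oo%E] \is a fin_num.
    rewrite fineB//; last by rewrite ge0_fin_numE.
    by congr (_ - _); exact: (esym (congr1 fine mu1)).
  rewrite ge0_fin_numE// (le_lt_trans _ muD)// le_measure ?inE//.
  by move=> z ->; rewrite /nonpos_ereal /= leNye.
have n0 n : 0 < n.+1%:R :> R by rewrite ltr0n.
apply: unit_mean_cvg_indic => //.
- exact: measurableC.
- by move=> n; exact: cont01_ckernel.
- by move=> n y y01; have /andP[k0 k1] := ckernel_is_prob (n0 n) y01; rewrite ger0_norm.
move=> z Dz; have [->|z0] := eqVneq z -oo%E.
  rewrite indicE memNset//=. 
  by rewrite unit_of_Ny; under eq_fun do rewrite ckernel0; exact: cvg_cst.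
rewrite indicE mem_set//=; last by move=> /= z0'; rewrite z0' eqxx in z0.
have z01 := unit_of_prob Dz.
have y1 : 0 < unit_of z.
  rewrite lt_neqAle; case/andP: (z01) => -> _; rewrite andbT.
  apply: contra z0 => /eqP; rewrite -unit_of_Ny => /(congr1 (@nonpos_of R)).
  by rewrite !unit_ofK => ->.
set y := unit_of z in z01 y1 *.
have sq : (fun n => 1 - n.+1%:R^-1 * (y^-1)) @ \oo --> (1 : R).
  rewrite -[X in _ --> X]subr0; apply: cvgB; first exact: cvg_cst.
  rewrite -[X in _ --> X](mul0r (y^-1)); apply: cvgMl.
  exact: cvg_harmonic.
apply: (squeeze_cvgr _ sq); last exact: cvg_cst.
apply: nearW => n.
have /andP[k0 k1] := ckernel_is_prob (n0 n) z01; rewrite k1 andbT.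
have d0 := ckernel_den_gt0 (n0 n) z01.
rewrite /ckernel ler_pdivlMr// mulrBl mul1r -invfM.
have ny : 0 < n.+1%:R * y by rewrite mulr_gt0.
case/andP: z01 => y0 y1'.
rewrite lerBlDr -lerBlDl addrK.
rewrite mulrC ler_pdivlMr//; nra.
Qed.

Lemma tcauchy_bounds (t : R) : 0 < t -> atom0 <= tcauchy t <= 1 - atomN.
Proof.
move=> t0; apply/andP; split.
  have /cvgrPdist_lt/(_ _ t0) ht := @cvg_harmonic R.
  apply: (cvgr_to_le tcauchy_cvg0); near=> n; apply: tcauchy_le; rewrite ?invr_gt0//.
  rewrite (le_trans (ler_norm _))// -normrN -[- _]sub0r ltW//.
  by near: n.
apply: (cvgr_to_ge tcauchy_cvgy); near=> n; apply: tcauchy_le => //.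
rewrite (le_trans (ltW (truncnS_gt t)))// ler_nat ltnS.
by near: n; exact: nbhs_infty_ge.
Unshelve. all: by end_near. Qed.

(** The increments of the kernel over two intervals of t are comparable: the quotient
    of kernel (v) - kernel (u) by kernel (t) - kernel (s) is bounded on [0, 1]. So if the
    mean did not increase from s to t it would be constant, whereas its limits at 0 and
    at infinity are distinct. *)
Lemma tcauchy_lt (s t : R) : atom0 < 1 - atomN -> 0 < s -> s < t -> tcauchy s < tcauchy t.
Proof.
move=> a01 s0 st; have t0 := lt_trans s0 st.
rewrite ltNge; apply/negP => ts.
have flat (u v : R) : 0 < u -> u <= v -> tcauchy v <= tcauchy u.
  move=> u0 uv; have v0 := lt_le_trans u0 uv.
  pose C := (v - u) * ((1 + t) * (1 + s)) / ((t - s) * (Num.min 1 v * Num.min 1 u)).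
  have mn (x y : R) : 0 < x -> 0 <= y <= 1 -> 0 < Num.min 1 x <= 1 - y + x * y.
    move=> x0 /andP[y0 y1]; rewrite lt_min x0 ltr01/=.
    by rewrite ge_min; have [x1|x1] := leP 1 x; apply/orP; [left|right]; nra.
  have mx (x y : R) : 0 < x -> 0 <= y <= 1 -> 1 - y + x * y <= 1 + x.
    by move=> x0 /andP[y0 y1]; nra.
  have /andP[mu0 _] := mn u 0 u0 (introT andP (conj (lexx 0) ler01)).
  have /andP[mv0 _] := mn v 0 v0 (introT andP (conj (lexx 0) ler01)).
  have ts0 : 0 < t - s by rewrite subr_gt0.
  have C0 : 0 <= C.
    rewrite divr_ge0// ?mulr_ge0 ?subr_ge0 ?(ltW mu0) ?(ltW mv0) ?(ltW st)//; lra.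
  have le y : 0 <= y <= 1 ->
    ckernel v y <= C * (ckernel t y + (-1) * ckernel s y) + ckernel u y.
    move=> y01; rewrite mulN1r -lerBlDr !ckernel_sub//.
    have /andP[_ hu] := mn u y u0 y01; have /andP[_ hv] := mn v y v0 y01.
    have hs := mx s y s0 y01; have ht := mx t y t0 y01.
    have dv := ckernel_den_gt0 v0 y01; have du := ckernel_den_gt0 u0 y01.
    have dt := ckernel_den_gt0 t0 y01; have ds := ckernel_den_gt0 s0 y01.
    set p := y * (1 - y); have p0 : 0 <= p by rewrite mulr_ge0//; lra.
    set dv' := 1 - y + v * y in hv dv *; set du' := 1 - y + u * y in hu du *.
    set dt' := 1 - y + t * y in ht dt *; set ds' := 1 - y + s * y in hs ds *.
    have -> : C * ((t - s) * p / (dt' * ds')) =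
      (v - u) * p * ((1 + t) * (1 + s) / (dt' * ds')) / (Num.min 1 v * Num.min 1 u).
      by rewrite /C; field; rewrite !gt_eqF.
    have h1 : 1 <= (1 + t) * (1 + s) / (dt' * ds').
      by rewrite ler_pdivlMr ?mulr_gt0// mul1r ler_pM// ltW.
    have vp : 0 <= (v - u) * p by rewrite mulr_ge0 ?subr_ge0.
    apply: ler_pM => //; first by rewrite invr_ge0 mulr_ge0// ltW.
      by rewrite ler_peMr.
    by rewrite lef_pV2 ?posrE ?mulr_gt0// ler_pM// ltW.
  have ck := cont01_ckernel.
  have cc : cont01 (fun y => (-1) * ckernel s y + ckernel t y) by apply: cont01_lin;
    exact: ck.
  have : tcauchy v <= unit_mean mu (fun y =>
    C * ((-1) * ckernel s y + ckernel t y) + ckernel u y).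
    apply: le_unit_mean => //; [exact: ck|apply: cont01_lin => //; exact: ck|].
    by move=> y /le; rewrite [ckernel t y + _]addrC.
  rewrite unit_mean_lin//; [|exact: ck].
  rewrite unit_mean_lin//; [|exact: ck|exact: ck].
  rewrite -!/(tcauchy _) => /le_trans; apply.
  rewrite -[leRHS]add0r lerD2r mulr_ge0_le0//; lra.
have eqphi n : tcauchy n.+1%:R = tcauchy 1.
  have n1 : 1 <= n.+1%:R :> R by rewrite ler1n.
  by apply/le_anti/andP; split; [exact: flat|exact: tcauchy_le].
have eqphi' n : tcauchy n.+1%:R^-1 = tcauchy 1.
  have n0 : 0 < n.+1%:R^-1 :> R by rewrite invr_gt0 ltr0n.
  have n1 : n.+1%:R^-1 <= 1 :> R by rewrite invf_le1 ?ltr0n// ler1n.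
  by apply/le_anti/andP; split; [exact: tcauchy_le|exact: flat].
have a1 : atom0 = tcauchy 1.
  have := tcauchy_cvg0; rewrite (_ : (fun n => _) = (fun=> tcauchy 1)); last exact/funext.
  by move=> h; apply: (cvg_unique _ h); [exact: Rhausdorff|exact: cvg_cst].
have a2 : 1 - atomN = tcauchy 1.
  have := tcauchy_cvgy; rewrite (_ : (fun n => _) = (fun=> tcauchy 1)); last exact/funext.
  by move=> h; apply: (cvg_unique _ h); [exact: Rhausdorff|exact: cvg_cst].
by move: a01; rewrite a1 a2 ltxx.
Qed.

Lemma tcauchy_inj (s t : R) : atom0 < 1 - atomN -> 0 < s -> 0 < t ->
  tcauchy s = tcauchy t -> s = t.
Proof.
move=> a01 s0 t0 st; have [lt|lt|//] := ltgtP s t.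
  by have := tcauchy_lt a01 s0 lt; rewrite st ltxx.
by have := tcauchy_lt a01 t0 lt; rewrite st ltxx.
Qed.

Lemma tcauchy_bounds_lt (t : R) : atom0 < 1 - atomN -> 0 < t ->
  atom0 < tcauchy t < 1 - atomN.
Proof.
move=> a01 t0; have t20 : 0 < t / 2 by rewrite divr_gt0.
have /andP[h1 _] := tcauchy_bounds t20.
have /andP[_ h2] := tcauchy_bounds (addr_gt0 t0 ltr01).
rewrite (le_lt_trans h1) ?(lt_le_trans _ h2)//.
  by apply: tcauchy_lt => //; rewrite ltrDl.
by apply: tcauchy_lt => //; lra.
Qed.

Lemma tcauchy_surj (a : R) : atom0 < a < 1 - atomN -> exists2 t, 0 < t & tcauchy t = a.
Proof.
move=> /andP[a0 a1].
have [n1 hn1] : exists n, tcauchy n.+1%:R^-1 < a.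
  have d0 : 0 < a - atom0 by rewrite subr_gt0.
  have /cvgrPdist_lt/(_ _ d0) [N _ /(_ N (leqnn N))] := tcauchy_cvg0.
  by rewrite /= ltr_norml => /andP[h _]; exists N; lra.
have [n2 hn2] : exists n, a < tcauchy n.+1%:R.
  have d0 : 0 < 1 - atomN - a by rewrite subr_gt0.
  have /cvgrPdist_lt/(_ _ d0) [N _ /(_ N (leqnn N))] := tcauchy_cvgy.
  by rewrite /= ltr_norml => /andP[_ h]; exists N; lra.
have x0 : 0 < n1.+1%:R^-1 :> R by rewrite invr_gt0 ltr0n.
have x1 : n1.+1%:R^-1 <= 1 :> R by rewrite invf_le1 ?ltr0n// ler1n.
have xy : n1.+1%:R^-1 <= n2.+1%:R :> R by rewrite (le_trans x1)// ler1n.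
have cphi : {within `[n1.+1%:R^-1, n2.+1%:R], continuous tcauchy}.
  apply: continuous_in_subspaceT => x; rewrite inE /= in_itv /= => /andP[hx _].
  exact/tcauchy_continuous/(lt_le_trans x0).
have [|c] := IVT xy cphi (v := a).
  by rewrite ge_min le_max (ltW hn1) (ltW hn2) orbT.
by rewrite in_itv/= => /andP[hc _] <-; exists c => //; exact: lt_le_trans hc.
Qed.

Lemma tcauchy_invK (t : R) : atom0 < 1 - atomN -> 0 < t ->
  tcauchy_inv mu (tcauchy t) = t.
Proof.
move=> a01 t0; rewrite /tcauchy_inv /tcauchy -(mul_cauchyE t0 mu1).
apply: (pinvKV _ _ : {in _, cancel (fun t => t * Defs.cauchy mu t) _}); last first.
  by rewrite inE /= in_itv/= t0.
move=> x y; rewrite !inE /= !in_itv/= !andbT => x0 y0.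
by rewrite !mul_cauchyE// => /(tcauchy_inj a01 x0 y0).
Qed.

End OneMeasure.

(** Apply [unit_mean_cvg_of_ckernel] to a constant sequence. *)
Lemma unit_mean_eq_of_tcauchy nu mu : nu D = 1%E -> mu D = 1%E ->
  (forall t, 0 < t -> tcauchy nu t = tcauchy mu t) ->
  forall g, cont01 g -> unit_mean nu g = unit_mean mu g.
Proof.
move=> nu1 mu1 pE g cg.
have h : unit_mean ((fun=> nu) n) g @[n --> \oo] --> unit_mean mu g.
  apply: (@unit_mean_cvg_of_ckernel _ (fun=> nu) mu) => //; first exact: nearW.
  by move=> t t0; rewrite -/(tcauchy mu t) -pE//; exact: cvg_cst.
exact: (cvg_unique _ (cvg_cst _) h).
Qed.

(** Continuous functions that decrease to the indicator function of [r, +oo[ as n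
    grows. *)
Definition ramp (r : R) (n : nat) (y : R) : R := 1 / (1 + n%:R * (`|r - y| + (r - y))).

Lemma ramp_den (r : R) n y : 1 <= 1 + n%:R * (`|r - y| + (r - y)).
Proof.
by rewrite lerDl mulr_ge0// -lerBlDr sub0r -normrN ler_norm.
Qed.

Lemma cont01_ramp (r : R) n : cont01 (ramp r n).
Proof.
apply: cont01_div; first exact: cont01_cst.
  apply: continuous_subspaceT => y.
  have c : (r - y) @[y --> y] --> r - y by apply: cvgB; [exact: cvg_cst|exact: cvg_id].
  apply: cvgD; first exact: cvg_cst.
  apply: cvgM; first exact: cvg_cst.
  by apply: cvgD => //; exact: cvg_norm.
by move=> y _; rewrite gt_eqF// (lt_le_trans ltr01) ?ramp_den.
Qed.

Lemma ramp_cvg (r y : R) : ramp r n y @[n --> \oo] --> ((r <= y)%R%:R : R).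
Proof.
have [ry|yr] := leP r y.
  apply: cvg_near_cst; apply: nearW => n.
  by rewrite /ramp ler0_norm ?subr_le0// addNr mulr0 addr0 divr1.
have d0 : 0 < 2 * (r - y) by rewrite mulr_gt0// subr_gt0.
rewrite -cvg_shiftS /=.
have sq : (fun n => n.+1%:R^-1 * (2 * (r - y))^-1) @ \oo --> (0 : R).
  rewrite -[X in _ --> X](mul0r (2 * (r - y))^-1); apply: cvgMl.
  exact: cvg_harmonic.
apply: (squeeze_cvgr _ (cvg_cst 0) sq); apply: nearW => n.
have den := ramp_den r n.+1 y.
have den0 := lt_le_trans ltr01 den.
rewrite /ramp div1r invr_ge0 (ltW den0)/= -invfM lef_pV2 ?posrE//.
  by rewrite gtr0_norm ?subr_gt0// -mulr2n mulr_natl lerDr.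
by rewrite mulr_gt0// ltr0n.
Qed.

Lemma probability_restr (nu : probability (\bar R) R) A : supported_nonpos nu ->
  measurable A -> nu A = nu (A `&` D).
Proof.
move=> nu1 mA; have mD := @measurable_nonpos R.
rewrite -[in LHS](setIT A) -(setUv D) setIUr measureU//; last 3 first.
- exact: measurableI.
- by apply: measurableI => //; exact: measurableC.
- by rewrite -setIIr setICr setI0.
rewrite [X in (_ + X)%E](_ : _ = 0%E) ?adde0//.
apply/eqP; rewrite eq_le measure_ge0 andbT.
have -> : 0%E = nu (~` D) by rewrite probability_setC// nu1 subee.
apply: le_measure; rewrite ?inE//.
- by apply: measurableI => //; exact: measurableC.
- exact: measurableC.
Qed.

Lemma measure_eq_of_tcauchy (nu mu : probability (\bar R) R) :
  supported_nonpos nu -> supported_nonpos mu ->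
  (forall t, 0 < t -> tcauchy nu t = tcauchy mu t) ->
  forall A, measurable A -> nu A = mu A.
Proof.
move=> nu1 mu1 pE A mA.
pose Y : \bar R -> measurableTypeR R := @unit_of R.
have mY : measurable_fun setT Y by exact: measurable_unit_of.
pose mYm := isMeasurableFun.Build _ _ (\bar R) (measurableTypeR R) Y mY.
pose Y' : {mfun \bar R >-> measurableTypeR R} := HB.pack Y mYm.
have mZ : measurable_fun [set: measurableTypeR R] (@nonpos_of R).
  by have := @measurable_nonpos_of_homo R id; apply.
have mZA : measurable ((@nonpos_of R : measurableTypeR R -> _) @^-1` A).
  by have := mZ measurableT _ mA; rewrite setTI.
have AE : A = Y @^-1` ((@nonpos_of R) @^-1` A).
  by apply/seteqP; split => z /=; rewrite /Y unit_ofK.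
suff : distribution nu Y' ((@nonpos_of R) @^-1` A) =
       distribution mu Y' ((@nonpos_of R) @^-1` A).
  by rewrite /distribution /pushforward /= -AE.
apply: (@measure_unique _ R (measurableTypeR R) (@RGenCInfty.G R)
  (fun n => `[- n%:R, +oo[%classic) _ _ _ _ (distribution nu Y') (distribution mu Y'))
    => //.
- exact: RGenCInfty.measurableE.
- move=> _ _ [x ->] [y ->]; exists (Num.max x y).
  apply/seteqP; split => z /=; rewrite !in_itv/= !andbT ge_max.
    by move=> [-> ->].
  by move/andP.
- by move=> n; exists (- n%:R).
- apply/seteqP; split => // x _; exists (Num.truncn `|x|).+1 => //=.
  rewrite in_itv/= andbT lerNl (le_trans _ (ltW (truncnS_gt _)))//.
  by rewrite -normrN ler_norm.
- move=> _ [r ->]; pose Ar : set (\bar R) := Y @^-1` `[r, +oo[%classic.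
  rewrite -[LHS]/(nu Ar) -[RHS]/(mu Ar).
  have mAr : measurable Ar.
    by have := mY measurableT _ (measurable_itv `[r, +oo[); rewrite setTI.
  rewrite (probability_restr nu1 mAr) (probability_restr mu1 mAr).
  have cvg_ar (m : probability (\bar R) R) : supported_nonpos m ->
      unit_mean m (ramp r n) @[n --> \oo] --> fine (m (Ar `&` D)).
    move=> m1; apply: unit_mean_cvg_indic => //.
    - by move=> n; exact: cont01_ramp.
    - move=> n y _; have den := ramp_den r n y; have den0 := lt_le_trans ltr01 den.
      by rewrite /ramp div1r ger0_norm ?invr_ge0 ?(ltW den0)// invf_le1.
    - move=> z _; rewrite (_ : \1_Ar z = (r <= unit_of z)%R%:R); first exact: ramp_cvg.
      by rewrite indicE; congr ((nat_of_bool _)%:R); apply/idP/idP;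
        rewrite inE /Ar /= in_itv/= andbT.
  have finm (m : probability (\bar R) R) : m (Ar `&` D) \is a fin_num.
    by apply: fin_num_measure; apply: measurableI => //; exact: measurable_nonpos.
  rewrite -(fineK (finm nu)) -(fineK (finm mu)); congr EFin.
  have := cvg_ar _ nu1; rewrite (_ : (fun n => _) = (fun n => unit_mean mu (ramp r n))).
    by move=> h; exact: (cvg_unique _ h (cvg_ar _ mu1)).
  by apply/funext => n; apply: unit_mean_eq_of_tcauchy => //; exact: cont01_ramp.
- by move=> n; rewrite (le_lt_trans (probability_le1 _ _)) ?ltry//; exact: measurable_itv.
Qed.

End CauchyTransform.

(** * The Hadamard product of two sequences of polynomials *)
Section HadamardStructure.
Variable R : realType.
Variables (n : nat) (P Q : {poly R}).
Hypotheses (P0 : P != 0) (Q0 : Q != 0).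
Hypotheses (sP : (size P <= n.+1)%N) (sQ : (size Q <= n.+1)%N).
Hypotheses (rP : nonpos_rooted P) (rQ : nonpos_rooted Q).
Let cs := negzeros P.
Let ds := negzeros Q.

Lemma coef_hadamard k : (hadamard n P Q)`_k =
  lead_coef P * lead_coef Q * ((prodXD cs)`_k * (prodXD ds)`_k).
Proof.
rewrite coef_poly; case: ltnP => kn; last first.
  by rewrite [(prodXD cs)`_k]nth_default ?mul0r ?mulr0// size_prodXD (leq_trans _ kn)//
    ltnS size_negzeros_le.
rewrite {1}(poly_negzerosE P0 rP) {1}(poly_negzerosE Q0 rQ) !coefZ.
by rewrite -/cs -/ds; ring.
Qed.

Local Notation toC := (real_complex R).

Lemma hadamard_nonpos_rooted : hadamard n P Q != 0 -> nonpos_rooted (hadamard n P Q).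
Proof.
move=> H0 z; have l0 : lead_coef P * lead_coef Q != 0 by rewrite mulf_neq0 ?lead_coef_eq0.
have prodC es : map_poly toC (prodXD es) = prodXD [seq toC e | e <- es].
  rewrite /prodXD rmorph_prod big_map; apply: eq_bigr => e _.
  by rewrite rmorphD /= map_polyX map_polyC.
pose F := \poly_(k < n.+1) ((prodXD [seq toC e | e <- cs])`_k * (prodXD [seq toC e | e
  <- ds])`_k).
have HE : complex_poly (hadamard n P Q) = toC (lead_coef P * lead_coef Q) *: F.
  apply/polyP => k; rewrite coef_map coef_hadamard coefZ [LHS]rmorphM; congr (_ * _).
  rewrite coef_poly -!prodC !coef_map -rmorphM; case: ltnP => // kn.
  rewrite [(prodXD cs)`_k]nth_default ?mul0r ?rmorph0// size_prodXD (leq_trans _ kn)//.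
  by rewrite ltnS size_negzeros_le.
have lC0 : toC (lead_coef P * lead_coef Q) != 0 by rewrite fmorph_eq0.
rewrite HE rootZ//; apply: hadamard_root_le0.
- by rewrite size_map ltnS size_negzeros_le.
- by rewrite all_map; apply: sub_all (negzeros_ge0 P0 rP) => c /= c0; rewrite ler0c.
- by rewrite all_map; apply: sub_all (negzeros_ge0 Q0 rQ) => c /= c0; rewrite ler0c.
- have := complex_poly_neq0 H0; rewrite HE scaler_eq0 negb_or => /andP[_]; exact.
Qed.

Lemma hadamard_prodXD : hadamard n P Q != 0 ->
  exists2 h : R, 0 < h & forall k, (prodXD cs)`_k * (prodXD ds)`_k =
     h * (prodXD (negzeros (hadamard n P Q)))`_k.
Proof.
move=> H0; have rH := hadamard_nonpos_rooted H0.
have l0 : lead_coef P * lead_coef Q != 0 by rewrite mulf_neq0 ?lead_coef_eq0.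
pose h := lead_coef (hadamard n P Q) / (lead_coef P * lead_coef Q).
have hE k : (prodXD cs)`_k * (prodXD ds)`_k =
     h * (prodXD (negzeros (hadamard n P Q)))`_k.
  apply: (mulfI l0); rewrite -coef_hadamard {1}(poly_negzerosE H0 rH) coefZ /h.
  by field; rewrite !lead_coef_eq0 P0 Q0.
exists h => //; rewrite lt_def mulf_neq0 ?invr_eq0 ?lead_coef_eq0//=.
have := hE (size (negzeros (hadamard n P Q))).
have -> : (prodXD (negzeros (hadamard n P Q)))`_(size (negzeros (hadamard n P Q))) = 1.
  have m : prodXD (negzeros (hadamard n P Q)) \is monic.
    rewrite /prodXD rpred_prod// => c _; rewrite -[c]opprK polyCN; exact: monicXsubC.
  by move/monicP: m; rewrite lead_coefE size_prodXD.
rewrite mulr1 => <-; apply: mulr_ge0; apply: coef_prodXD_ge0; exact: negzeros_ge0.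
Qed.

End HadamardStructure.

Section MeanConvergence.
Variable R : realType.

(** This is t G(t) for the zero distribution with n zeros. *)
Definition tcauchy_zeros (n : nat) (cs : seq R) (t : R) : R :=
  n%:R^-1 * \sum_(y <- unit_zeros n cs) ckernel t y.

Variables (cs ds : nat -> seq R) (f1 f2 : R -> R).
Hypothesis csP : \forall n \near \oo, (size (cs n) <= n)%N /\ all (>= 0) (cs n).
Hypothesis dsP : \forall n \near \oo, (size (ds n) <= n)%N /\ all (>= 0) (ds n).
Hypothesis cvg_cs : forall t, 0 < t -> tcauchy_zeros n (cs n) t @[n --> \oo] --> f1 t.
Hypothesis cvg_ds : forall t, 0 < t -> tcauchy_zeros n (ds n) t @[n --> \oo] --> f2 t.

Lemma sum_ckernelE n c t : (0 < n)%N ->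
  \sum_(y <- unit_zeros n c) ckernel t y = n%:R * tcauchy_zeros n c t.
Proof. by move=> n0; rewrite /tcauchy_zeros mulrA divff ?mul1r// pnatr_eq0 -lt0n. Qed.

Lemma near_coef_gt0 (c : nat -> seq R) (f : R -> R) (s1 s2 b : R) :
  (\forall n \near \oo, (size (c n) <= n)%N /\ all (>= 0) (c n)) ->
  (forall t, 0 < t -> tcauchy_zeros n (c n) t @[n --> \oo] --> f t) ->
  0 < s1 -> 0 < s2 -> 0 <= b -> f s1 < b < f s2 ->
  \forall n \near \oo, 0 < (prodXD (c n))`_(Num.truncn (b * n%:R)).
Proof.
move=> cP fP s10 s20 b0 /andP[b1 b2].
have d1 : 0 < (b - f s1) / 2 by rewrite divr_gt0// subr_gt0.
have d2 : 0 < f s2 - b by rewrite subr_gt0.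
have /cvgrPdist_lt/(_ _ d1) h1 := fP s1 s10.
have /cvgrPdist_lt/(_ _ d2) h2 := fP s2 s20.
near=> n.
have n0 : (0 < n)%N by near: n; exact: nbhs_infty_gt.
have nR : 0 < n%:R :> R by rewrite ltr0n.
have nbig : ((b - f s1) / 2)^-1 <= n%:R by near: n; exact: nbhs_infty_ger.
suff : (size (c n) <= n)%N /\ all (>= 0) (c n) ->
  0 < (prodXD (c n))`_(Num.truncn (b * n%:R)).
  by apply; near: n.
move=> [_ cn0]; apply: (@coef_gt0_of_means _ n _ s1 s2) => //.
have e1 : `|f s1 - tcauchy_zeros n (c n) s1| < (b - f s1) / 2 by near: n.
have e2 : `|f s2 - tcauchy_zeros n (c n) s2| < f s2 - b by near: n.
rewrite !sum_ckernelE//; have /andP[t1 t2] := truncn_itv (mulr_ge0 b0 (ltW nR)).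
move: e1 e2; rewrite !ltr_norml => /andP[e1 e1'] /andP[e2 e2'].
have nb : 1 <= (b - f s1) / 2 * n%:R by rewrite -ler_pdivrMl ?mulr1.
move: t2; rewrite -natr1 => t2; apply/andP; split.
  have : n%:R * tcauchy_zeros n (c n) s1 <= n%:R * (f s1 + (b - f s1) / 2).
    by rewrite ler_pM2l//; lra.
  nra.
apply: (le_trans t1); rewrite mulrC ler_pM2l//; lra.
Unshelve. all: by end_near. Qed.

Variables (es : nat -> seq R).
Hypothesis esP : \forall n \near \oo, [/\ (size (es n) <= n)%N, all (>= 0) (es n) &
  exists2 h : R, 0 < h &
    forall k, (prodXD (cs n))`_k * (prodXD (ds n))`_k = h * (prodXD (es n))`_k].
Variables (s t s1 t1 s2 t2 a : R).
Hypotheses (s0 : 0 < s) (t0 : 0 < t) (s10 : 0 < s1) (t10 : 0 < t1) (s20 : 0 <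
  s2) (t20 : 0 < t2).
Hypotheses (a0 : 0 <= f1 s1) (a1 : f1 s2 <= 1).
Hypotheses (f1s : f1 s = a) (f2t : f2 t = a).
Hypotheses (f1s1 : f1 s1 < a) (f2t1 : f2 t1 < a) (f1s2 : a < f1 s2) (f2t2 : a < f2 t2).

(** Apply [hadamard_mean_gt] at k close to b n, with b slightly below a. The
    auxiliary points s1 and t1, where the limits are below b, guarantee
    that the k-th coefficients are positive. *)
Lemma tcauchy_zeros_hadamard_ge (e : R) : 0 < e ->
  \forall n \near \oo, a - e < tcauchy_zeros n (es n) (s * t).
Proof.
move=> e0; pose m := Num.max (Num.max (f1 s1) (f2 t1)) (a - e / 2).
have ma : m < a by rewrite /m !gt_max f1s1 f2t1 /=; lra.
have [m1 m2 m3] : [/\ f1 s1 <= m, f2 t1 <= m & a - e / 2 <= m].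
  by rewrite /m !le_max !lexx !orbT.
pose b := (m + a) / 2; pose g := a - b.
have g0 : 0 < g by rewrite /g /b; lra.
have b0 : 0 < b by rewrite /b; have := a0; have := m1; have := ma; lra.
pose r := Num.min 1 (g / 8).
have r01 : 0 < r <= 1 by rewrite /r lt_min ltr01 divr_gt0//= ge_min lexx.
have r8 : r <= g / 8 by rewrite /r ge_min lexx orbT.
have g4 : 0 < g / 4 by rewrite divr_gt0.
have cpos : \forall n \near \oo, 0 < (prodXD (cs n))`_(Num.truncn (b * n%:R)).
  apply: near_coef_gt0 csP cvg_cs s10 s0 (ltW b0) _; rewrite f1s /b; apply/andP; split; lra.
have dpos : \forall n \near \oo, 0 < (prodXD (ds n))`_(Num.truncn (b * n%:R)).
  apply: near_coef_gt0 dsP cvg_ds t10 t0 (ltW b0) _; rewrite f2t /b; apply/andP; split; lra.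
have /cvgrPdist_lt/(_ _ g4) h1 := cvg_cs s0.
have /cvgrPdist_lt/(_ _ g4) h2 := cvg_ds t0.
near=> n.
have n0 : (0 < n)%N by near: n; exact: nbhs_infty_gt.
have nR : 0 < n%:R :> R by rewrite ltr0n.
have nbig1 : (r ^+ 3)^-1 <= n%:R by near: n; exact: nbhs_infty_ger.
have nbig2 : b^-1 <= n%:R by near: n; exact: nbhs_infty_ger.
have nbig3 : (e / 4)^-1 <= n%:R by near: n; exact: nbhs_infty_ger.
have r30 : 0 < r ^+ 3 by rewrite exprn_gt0//; case/andP: r01.
have rn : 1 <= r ^+ 3 * n%:R by rewrite -ler_pdivrMl ?mulr1.
have bn : 1 <= b * n%:R by rewrite -ler_pdivrMl ?mulr1.
have en : 1 <= e / 4 * n%:R by rewrite -ler_pdivrMl ?mulr1// divr_gt0.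
set k := Num.truncn (b * n%:R).
have /andP[k1 k2] := truncn_itv (mulr_ge0 (ltW b0) (ltW nR)).
have kn : (0 < k <= n)%N.
  rewrite truncn_gt0 bn /= -(ler_nat R) (le_trans k1)//.
  rewrite ger_pMl// /b; have := a1; have := f1s2; have := ma; lra.
have ck : 0 < (prodXD (cs n))`_k by rewrite /k; near: n.
have dk : 0 < (prodXD (ds n))`_k by rewrite /k; near: n.
have e1 : `|f1 s - tcauchy_zeros n (cs n) s| < g / 4 by near: n.
have e2 : `|f2 t - tcauchy_zeros n (ds n) t| < g / 4 by near: n.
have csn : (size (cs n) <= n)%N /\ all (>= 0) (cs n) by near: n.
have dsn : (size (ds n) <= n)%N /\ all (>= 0) (ds n) by near: n.
have esn : [/\ (size (es n) <= n)%N, all (>= 0) (es n) &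
  exists2 h : R, 0 < h &
    forall k, (prodXD (cs n))`_k * (prodXD (ds n))`_k = h * (prodXD (es n))`_k] by near: n.
have [scs cs0] := csn; have [sds ds0] := dsn; have [ses es0 [h h0 hE]] := esn.
move: e1 e2; rewrite !ltr_norml f1s f2t => /andP[e1 e1'] /andP[e2 e2'].
have lowk (c : seq R) u : a - g / 4 <= tcauchy_zeros n c u ->
    k%:R + 3 * r * n%:R <= \sum_(y <- unit_zeros n c) ckernel u y.
  move=> cu; rewrite sum_ckernelE//.
  have : n%:R * (a - g / 4) <= n%:R * tcauchy_zeros n c u by rewrite ler_pM2l.
  have : r * n%:R <= g / 8 * n%:R by rewrite ler_pM2r.
  by have := mulr_gt0 g0 nR; move: k1; rewrite -/k /g; lra.
have := @hadamard_mean_gt _ n (cs n) (ds n) (es n) h cs0 ds0 es0 scs sds ses h0 hE s t r k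
  s0 t0 kn r01 rn ck dk (lowk _ _ _) (lowk _ _ _).
rewrite sum_ckernelE// => H.
have {}H : k%:R - 3 * r * n%:R < n%:R * tcauchy_zeros n (es n) (s * t) by apply: H; lra.
rewrite -(ltr_pM2l nR); apply: le_lt_trans H.
have : r * n%:R <= g / 8 * n%:R by rewrite ler_pM2r.
move: k2; rewrite -/k -natr1 => k2.
have : g * n%:R <= e / 4 * n%:R by rewrite ler_pM2r// /g /b; lra.
by move: k2 en; rewrite /g; lra.
Unshelve. all: by end_near. Qed.

(** Symmetric, with b slightly above a. *)
Lemma tcauchy_zeros_hadamard_le (e : R) : 0 < e ->
  \forall n \near \oo, tcauchy_zeros n (es n) (s * t) < a + e.
Proof.
move=> e0; pose m := Num.min (Num.min (f1 s2) (f2 t2)) (a + e / 2).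
have ma : a < m by rewrite /m !lt_min f1s2 f2t2 /=; lra.
have [m1 m2 m3] : [/\ m <= f1 s2, m <= f2 t2 & m <= a + e / 2].
  by rewrite /m !ge_min !lexx !orbT.
pose b := (m + a) / 2; pose g := b - a.
have g0 : 0 < g by rewrite /g /b; lra.
have b0 : 0 < b by rewrite /b; have := a0; have := f1s1; have := ma; lra.
have b1 : 0 < 1 - b by rewrite /b; have := a1; have := m1; have := ma; lra.
pose r := Num.min 1 (g / 8).
have r01 : 0 < r <= 1 by rewrite /r lt_min ltr01 divr_gt0//= ge_min lexx.
have r8 : r <= g / 8 by rewrite /r ge_min lexx orbT.
have g4 : 0 < g / 4 by rewrite divr_gt0.
have cpos : \forall n \near \oo, 0 < (prodXD (cs n))`_(Num.truncn (b * n%:R)).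
  apply: near_coef_gt0 csP cvg_cs s0 s20 (ltW b0) _; rewrite f1s /b; apply/andP; split; lra.
have dpos : \forall n \near \oo, 0 < (prodXD (ds n))`_(Num.truncn (b * n%:R)).
  apply: near_coef_gt0 dsP cvg_ds t0 t20 (ltW b0) _; rewrite f2t /b; apply/andP; split; lra.
have /cvgrPdist_lt/(_ _ g4) h1 := cvg_cs s0.
have /cvgrPdist_lt/(_ _ g4) h2 := cvg_ds t0.
near=> n.
have n0 : (0 < n)%N by near: n; exact: nbhs_infty_gt.
have nR : 0 < n%:R :> R by rewrite ltr0n.
have nbig1 : (r ^+ 3)^-1 <= n%:R by near: n; exact: nbhs_infty_ger.
have nbig2 : (1 - b)^-1 <= n%:R by near: n; exact: nbhs_infty_ger.
have nbig3 : (e / 4)^-1 <= n%:R by near: n; exact: nbhs_infty_ger.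
have r30 : 0 < r ^+ 3 by rewrite exprn_gt0//; case/andP: r01.
have rn : 1 <= r ^+ 3 * n%:R by rewrite -ler_pdivrMl ?mulr1.
have bn : 1 <= (1 - b) * n%:R by rewrite -ler_pdivrMl ?mulr1.
have en : 1 <= e / 4 * n%:R by rewrite -ler_pdivrMl ?mulr1// divr_gt0.
set k := (Num.truncn (b * n%:R)).+1.
have /andP[k1 k2] := truncn_itv (mulr_ge0 (ltW b0) (ltW nR)).
have kn : (0 < k <= n)%N.
  by rewrite /= -(ler_nat R) -natr1; move: bn k1; rewrite mulrBl mul1r; lra.
have ck : 0 < (prodXD (cs n))`_k.-1 by rewrite /k /=; near: n.
have dk : 0 < (prodXD (ds n))`_k.-1 by rewrite /k /=; near: n.
have e1 : `|f1 s - tcauchy_zeros n (cs n) s| < g / 4 by near: n.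
have e2 : `|f2 t - tcauchy_zeros n (ds n) t| < g / 4 by near: n.
have csn : (size (cs n) <= n)%N /\ all (>= 0) (cs n) by near: n.
have dsn : (size (ds n) <= n)%N /\ all (>= 0) (ds n) by near: n.
have esn : [/\ (size (es n) <= n)%N, all (>= 0) (es n) &
  exists2 h : R, 0 < h &
    forall k, (prodXD (cs n))`_k * (prodXD (ds n))`_k = h * (prodXD (es n))`_k] by near: n.
have [scs cs0] := csn; have [sds ds0] := dsn; have [ses es0 [h h0 hE]] := esn.
move: e1 e2; rewrite !ltr_norml f1s f2t => /andP[e1 e1'] /andP[e2 e2'].
have rg : r * n%:R <= g / 8 * n%:R by rewrite ler_pM2r.
have upk (c : seq R) u : tcauchy_zeros n c u <= a + g / 4 ->
    \sum_(y <- unit_zeros n c) ckernel u y <= k%:R - 3 * r * n%:R.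
  move=> cu; rewrite sum_ckernelE//.
  have : n%:R * tcauchy_zeros n c u <= n%:R * (a + g / 4) by rewrite ler_pM2l.
  by have := mulr_gt0 g0 nR; move: k2; rewrite -/k; move: rg; rewrite /g; lra.
have := @hadamard_mean_lt _ n (cs n) (ds n) (es n) h cs0 ds0 es0 scs sds ses h0 hE s t r k
  s0 t0 kn r01 rn ck dk (upk _ _ _) (upk _ _ _).
rewrite sum_ckernelE// => H.
have H' : n%:R * tcauchy_zeros n (es n) (s * t) < k%:R + 3 * r * n%:R.
  by apply: H; move: e1 e2; lra.
rewrite -(ltr_pM2l nR); apply: lt_le_trans H' _.
have : g * n%:R <= e / 4 * n%:R by rewrite ler_pM2r// /g /b; lra.
have kE : k%:R = (Num.truncn (b * n%:R))%:R + 1 :> R by rewrite natr1.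
by have := mulr_gt0 g0 nR; move: k1 en rg; rewrite kE /g; lra.
Unshelve. all: by end_near. Qed.

Lemma tcauchy_zeros_hadamard_cvg : tcauchy_zeros n (es n) (s * t) @[n --> \oo] --> a.
Proof.
apply/cvgrPdist_lt => e e0; near=> n.
have h1 : a - e < tcauchy_zeros n (es n) (s * t) by near: n;
  exact: tcauchy_zeros_hadamard_ge.
have h2 : tcauchy_zeros n (es n) (s * t) < a + e by near: n;
  exact: tcauchy_zeros_hadamard_le.
by rewrite ltr_norml; lra.
Unshelve. all: by end_near. Qed.

End MeanConvergence.

(** * The product rule *)
Section Splitting.
Variable R : realType.
Local Notation D := (@nonpos_ereal R).
Variables (mu1 mu2 : {measure set (\bar R) -> \bar R}).
Hypotheses (m1 : mu1 D = 1%E) (m2 : mu2 D = 1%E).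

Lemma tcauchy_split_between (a b T : R) : 0 < a -> a <= b -> 0 < T ->
  tcauchy mu1 a <= tcauchy mu2 (T / a) -> tcauchy mu2 (T / b) <= tcauchy mu1 b ->
  exists s, 0 < s /\ tcauchy mu1 s = tcauchy mu2 (T / s).
Proof.
move=> a0 ab T0 ha hb; pose f s := tcauchy mu1 s - tcauchy mu2 (T / s).
have cf : {within `[a, b], continuous f}.
  apply: continuous_in_subspaceT => x; rewrite inE /= in_itv /= => /andP[ax _].
  have x0 := lt_le_trans a0 ax.
  apply: cvgB; first exact: tcauchy_continuous.
  have cT : {for x, continuous (fun s : R => T / s)}.
    by apply: cvgM; [exact: cvg_cst|apply: cvgV; [rewrite gt_eqF|exact: cvg_id]].
  have c2 : {for T / x, continuous (tcauchy mu2)} by apply: tcauchy_continuous;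
    rewrite ?divr_gt0.
  exact: (@continuous_comp _ _ _ (fun s : R => T / s) (tcauchy mu2) x cT c2).
have [|s] := IVT ab cf (v := 0).
  rewrite ge_min le_max; apply/andP; split; apply/orP.
    by left; rewrite subr_le0.
  by right; rewrite subr_ge0.
rewrite in_itv/= => /andP[sa _] /eqP; rewrite subr_eq0 => /eqP E.
by exists s; split => //; exact: lt_le_trans sa.
Qed.

(** The function s |-> tcauchy mu1 s - tcauchy mu2 (T / s) changes sign between s0 and
    T / t0: at either point one of its two terms is the common value at (s0, t0), and the
    other one compares with it by monotonicity. *)
Lemma tcauchy_split (s0 t0 T : R) : 0 < s0 -> 0 < t0 ->
  tcauchy mu1 s0 = tcauchy mu2 t0 -> 0 < T ->
  exists s, 0 < s /\ tcauchy mu1 s = tcauchy mu2 (T / s).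
Proof.
move=> s00 t00 E T0; have b0 : 0 < T / t0 by rewrite divr_gt0.
have bK : T / (T / t0) = t0 by rewrite invfM invrK mulrA divff ?mul1r// gt_eqF.
have [le|/ltW le] := leP s0 (T / t0).
  apply: (@tcauchy_split_between s0 (T / t0)) => //; rewrite ?bK ?E -?E.
    by rewrite E; apply: tcauchy_le => //; rewrite ler_pdivlMr// mulrC -ler_pdivlMr.
  by apply: tcauchy_le.
apply: (@tcauchy_split_between (T / t0) s0) => //; rewrite ?bK.
  by rewrite -E; apply: tcauchy_le.
rewrite E; apply: tcauchy_le => //; first by rewrite divr_gt0.
by rewrite ler_pdivrMr// mulrC -ler_pdivrMr.
Qed.

End Splitting.

Theorem theorem3p1 (R : realType) (P1 P2 : nat -> {poly R})
    (mu1 mu2 : probability (\bar R) R)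
    (hP1 : forall n, (0 < n)%N ->
       [/\ P1 n != 0, (size (P1 n) <= n.+1)%N & nonpos_rooted (P1 n)])
    (hP2 : forall n, (0 < n)%N ->
       [/\ P2 n != 0, (size (P2 n) <= n.+1)%N & nonpos_rooted (P2 n)])
    (hmu1 : supported_nonpos mu1) (hmu2 : supported_nonpos mu2)
    (cvg1 : weak_cvg_nonpos (fun n => zero_distr n (P1 n)) mu1)
    (cvg2 : weak_cvg_nonpos (fun n => zero_distr n (P2 n)) mu2)
    (hI : atom_itv mu1 `&` atom_itv mu2 !=set0) :
  (\forall n \near \oo, hadamard n (P1 n) (P2 n) != 0 /\
                        nonpos_rooted (hadamard n (P1 n) (P2 n))) /\
  exists mu : probability (\bar R) R,
    [/\ supported_nonpos mu,
        weak_cvg_nonpos (fun n => zero_distr n (hadamard n (P1 n) (P2 n))) mu,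
        product_rule mu1 mu2 mu &
        forall nu : probability (\bar R) R,
          supported_nonpos nu -> product_rule mu1 mu2 nu ->
          forall A : set (\bar R), measurable A -> nu A = mu A].
Proof.
pose H n := hadamard n (P1 n) (P2 n).
have itvE (m : {measure set (\bar R) -> \bar R}) a :
    atom_itv m a <-> atom0 m < a < 1 - atomN m.
  by rewrite /atom_itv /= in_itv.
have [a0 [/itvE a01 /itvE a02]] := hI.
have ne1 : atom0 mu1 < 1 - atomN mu1 by case/andP: a01; exact: lt_trans.
have ne2 : atom0 mu2 < 1 - atomN mu2 by case/andP: a02; exact: lt_trans.
have tcauchy_zeros_cvg (P : nat -> {poly R}) (m : probability (\bar R) R) :
    (forall n, (0 < n)%N -> [/\ P n != 0, (size (P n) <= n.+1)%N & nonpos_rooted (P n)]) ->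
    weak_cvg_nonpos (fun n => zero_distr n (P n)) m ->
    forall t, 0 < t -> tcauchy_zeros n (negzeros (P n)) t @[n --> \oo] --> tcauchy m t.
  move=> hP /weak_cvg_nonpos_unit_mean wc t t0.
  apply: cvg_trans (wc _ (cont01_ckernel t0)); apply: near_eq_cvg; near=> n.
  have n0 : (0 < n)%N by near: n; exact: nbhs_infty_gt.
  have [Pn0 sPn rPn] := hP n n0.
  rewrite unit_mean_zero_distr//; first exact: cont01_ckernel.
  by move=> y y01; have /andP[] := ckernel_is_prob t0 y01.
have k1 := tcauchy_zeros_cvg P1 mu1 hP1 cvg1; have k2 := tcauchy_zeros_cvg P2 mu2 hP2 cvg2.
have csP (P : nat -> {poly R}) :
    (forall n, (0 < n)%N -> [/\ P n != 0, (size (P n) <= n.+1)%N & nonpos_rooted (P n)]) ->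
    \forall n \near \oo, (size (negzeros (P n)) <= n)%N /\ all (>= 0) (negzeros (P n)).
  move=> hP; near=> n.
  have n0 : (0 < n)%N by near: n; exact: nbhs_infty_gt.
  by have [Pn0 sPn rPn] := hP n n0; split; [exact: size_negzeros_le|exact: negzeros_ge0].
have c1P := csP P1 hP1; have c2P := csP P2 hP2.
have [s0 s00 s0E] := tcauchy_surj hmu1 a01; have [t0 t00 t0E] := tcauchy_surj hmu2 a02.
have lt_half (x : R) : 0 < x -> 0 < x / 2 /\ x / 2 < x by move=> x0; split; lra.
have gt_twice (x : R) : 0 < x -> 0 < x * 2 /\ x < x * 2 by move=> x0; split; lra.
have bnd (m : probability (\bar R) R) t : supported_nonpos m -> 0 < t ->
  0 <= tcauchy m t <= 1.
  move=> m1 t0'; have /andP[b1 b2] := tcauchy_bounds m1 t0'.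
  rewrite (le_trans _ b1) ?fine_ge0//= (le_trans b2)// gerBl.
  exact: fine_ge0.
(* Near a0 n, the coefficients of both factors are positive. *)
have Hn0 : \forall n \near \oo, H n != 0.
  have [hs hs'] := lt_half _ s00; have [ht ht'] := lt_half _ t00.
  have [ds ds'] := gt_twice _ s00; have [dt dt'] := gt_twice _ t00.
  have a00 : 0 <= a0 by rewrite -s0E; case/andP: (bnd _ _ hmu1 s00).
  have h1 : \forall n \near \oo, 0 < (prodXD (negzeros (P1 n)))`_(Num.truncn (a0 * n%:R)).
    apply: (near_coef_gt0 c1P k1 hs ds a00).
    by rewrite -s0E; apply/andP; split; apply: tcauchy_lt.
  have h2 : \forall n \near \oo, 0 < (prodXD (negzeros (P2 n)))`_(Num.truncn (a0 * n%:R)).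
    apply: (near_coef_gt0 c2P k2 ht dt a00).
    by rewrite -t0E; apply/andP; split; apply: tcauchy_lt.
  near=> n.
  have n0 : (0 < n)%N by near: n; exact: nbhs_infty_gt.
  have [Pn0 sPn rPn] := hP1 n n0; have [Qn0 sQn rQn] := hP2 n n0.
  have g1 : 0 < (prodXD (negzeros (P1 n)))`_(Num.truncn (a0 * n%:R)) by near: n.
  have g2 : 0 < (prodXD (negzeros (P2 n)))`_(Num.truncn (a0 * n%:R)) by near: n.
  apply/negP => /eqP /(congr1 (fun p : {poly R} => p`_(Num.truncn (a0 * n%:R)))).
  rewrite coef0 coef_hadamard// => /eqP.
  by rewrite !mulf_eq0 !lead_coef_eq0 (negPf Pn0) (negPf Qn0) !gt_eqF.
have Hr : \forall n \near \oo, H n != 0 /\ nonpos_rooted (H n).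
  near=> n; have Hn : H n != 0 by near: n.
  have n0 : (0 < n)%N by near: n; exact: nbhs_infty_gt.
  have [Pn0 sPn rPn] := hP1 n n0; have [Qn0 sQn rQn] := hP2 n n0.
  by split => //; exact: hadamard_nonpos_rooted.
split; first exact: Hr.
have sH n : (size (H n) <= n.+1)%N by exact: size_poly.
have esP : \forall n \near \oo, [/\ (size (negzeros (H n)) <= n)%N,
  all (>= 0) (negzeros (H n)) &
    exists2 h : R, 0 < h &
      forall k, (prodXD (negzeros (P1 n)))`_k * (prodXD (negzeros (P2 n)))`_k
       = h * (prodXD (negzeros (H n)))`_k].
  near=> n.
  have [Hn rHn] : H n != 0 /\ nonpos_rooted (H n) by near: n.
  have n0 : (0 < n)%N by near: n; exact: nbhs_infty_gt.
  have [Pn0 sPn rPn] := hP1 n n0; have [Qn0 sQn rQn] := hP2 n n0.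
  split; [exact: size_negzeros_le|exact: negzeros_ge0|exact: hadamard_prodXD].
(* The auxiliary points s / 2 and s * 2 separate the value at s strictly. *)
have Hcvg s t : 0 < s -> 0 < t -> tcauchy mu1 s = tcauchy mu2 t ->
    tcauchy_zeros n (negzeros (H n)) (s * t) @[n --> \oo] --> tcauchy mu1 s.
  move=> s1 t1 st.
  have [hs hs'] := lt_half _ s1; have [ht ht'] := lt_half _ t1.
  have [ds ds'] := gt_twice _ s1; have [dt dt'] := gt_twice _ t1.
  apply: (@tcauchy_zeros_hadamard_cvg _ _ _ _ _ c1P c2P k1 k2 _ esP s t (s / 2) (t / 2)
    (s * 2) (t * 2)) => //.
  - by case/andP: (bnd _ _ hmu1 hs).
  - by case/andP: (bnd _ _ hmu1 ds).
  - exact: tcauchy_lt.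
  - by rewrite st; exact: tcauchy_lt.
  - exact: tcauchy_lt.
  - by rewrite st; exact: tcauchy_lt.
have split_ex T : 0 < T -> exists s, 0 < s /\ tcauchy mu1 s = tcauchy mu2 (T / s).
  by apply: (tcauchy_split hmu1 hmu2 s00 t00); rewrite s0E t0E.
pose sp T := if pselect (0 < T) is left T0 then projT1 (cid (split_ex T T0)) else 1.
have spP T : 0 < T -> 0 < sp T /\ tcauchy mu1 (sp T) = tcauchy mu2 (T / sp T).
  by move=> T0; rewrite /sp; case: pselect => // T0'; case: cid.
have [mu [mu1' muE]] : exists mu : probability (\bar R) R,
    mu (@nonpos_ereal R) = 1%E /\ forall t, 0 < t ->
      unit_mean mu (ckernel t) = tcauchy mu1 (sp t).
  apply: (@limit_measure_exists _ (fun n => unit_zeros n (negzeros (H n)))).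
    near=> n.
    have [Hn rHn] : H n != 0 /\ nonpos_rooted (H n) by near: n.
    split; first by apply: size_unit_zeros; exact: size_negzeros_le.
    by apply: unit_zeros_prob; exact: negzeros_ge0.
  move=> t t1; have [s1 sE] := spP t t1.
  have := Hcvg (sp t) (t / sp t) s1 (divr_gt0 t1 s1) sE.
  by rewrite mulrCA divff ?mulr1// gt_eqF.
have muK s t : 0 < s -> 0 < t -> tcauchy mu1 s = tcauchy mu2 t ->
  tcauchy mu (s * t) = tcauchy mu1 s.
  move=> s1 t1 st; have st0 : 0 < s * t by rewrite mulr_gt0.
  rewrite /tcauchy muE//; have [s2 sE] := spP _ st0.
  have := Hcvg (sp (s * t)) (s * t / sp (s * t)) s2 (divr_gt0 st0 s2) sE.
  rewrite mulrCA divff ?mulr1 ?gt_eqF// => h.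
  exact: (cvg_unique _ h (Hcvg s t s1 t1 st)).
(* The product rule presupposes that t G(t) is not constant for mu; two values suffice. *)
have ne : atom0 mu < 1 - atomN mu.
  have T0 : 0 < s0 * 2 * t0 by rewrite !mulr_gt0.
  have [s [s1 sE]] := split_ex _ T0.
  have b1 := tcauchy_bounds mu1' (mulr_gt0 s00 t00); have b2 := tcauchy_bounds mu1' T0.
  have e1 := muK s0 t0 s00 t00; rewrite s0E t0E in e1; have {}e1 := e1 erefl.
  have e2 := muK s _ s1 (divr_gt0 T0 s1) sE.
  rewrite mulrCA divff ?mulr1 ?gt_eqF// in e2.
  rewrite ltNge; apply/negP => le.
  have E : tcauchy mu1 s = a0 by rewrite -e1 -e2; move: b1 b2 le; lra.
  have ss : s = s0 by apply: (tcauchy_inj hmu1) => //; rewrite E s0E.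
  have tt : s0 * 2 * t0 / s = t0 by apply: (tcauchy_inj hmu2) => //;
    rewrite -?sE ?E ?t0E// divr_gt0.
  have : s0 * 2 * t0 / s0 = 2 * t0 by field; rewrite gt_eqF.
  by rewrite -{2}ss tt; move: t00; lra.
exists mu; split => //.
- apply/weak_cvg_nonpos_unit_mean; apply: unit_mean_cvg_of_ckernel => //.
    near=> n.
    have [Hn rHn] : H n != 0 /\ nonpos_rooted (H n) by near: n.
    have n0 : (0 < n)%N by near: n; exact: nbhs_infty_gt.
    exact: (zero_distr_mass n0 Hn (sH n) rHn).
  move=> t t1; have [s1 sE] := spP _ t1.
  have := Hcvg (sp t) (t / sp t) s1 (divr_gt0 t1 s1) sE.
  rewrite mulrCA divff ?mulr1 ?gt_eqF// -muE//; apply: cvg_trans.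
  apply: near_eq_cvg; near=> n.
  have [Hn rHn] : H n != 0 /\ nonpos_rooted (H n) by near: n.
  rewrite unit_mean_zero_distr//; [exact: sH|exact: cont01_ckernel|].
  by move=> y y01; have /andP[] := ckernel_is_prob t1 y01.
- split.
    apply/seteqP; split => [u /itvE/(tcauchy_surj mu1')[t t1 <-]|u [/itvE u1 /itvE u2]].
      have [s1 sE] := spP _ t1; have t2 := divr_gt0 t1 s1.
      have -> : tcauchy mu t = tcauchy mu1 (sp t) by exact: muE.
      split; apply/itvE; [|rewrite sE]; exact: tcauchy_bounds_lt.
    have [s s1 sE] := tcauchy_surj hmu1 u1; have [t t1 tE] := tcauchy_surj hmu2 u2.
    apply/itvE; rewrite -sE -(muK s t)// ?sE ?tE//.
    by apply: tcauchy_bounds_lt => //; rewrite mulr_gt0.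
  move=> u; rewrite inE => -[/itvE u1 /itvE u2].
  have [s s1 sE] := tcauchy_surj hmu1 u1; have [t t1 tE] := tcauchy_surj hmu2 u2.
  have st : tcauchy mu1 s = tcauchy mu2 t by rewrite sE tE.
  rewrite -{1}sE -(muK s t)// tcauchy_invK ?mulr_gt0//.
  by rewrite -{1}sE -tE !tcauchy_invK.
move=> nu nu1 [nuI nuE]; apply: measure_eq_of_tcauchy => // T T0.
have [s [s1 sE]] := split_ex _ T0; have t1 := divr_gt0 T0 s1.
have aI : (atom_itv mu1 `&` atom_itv mu2) (tcauchy mu1 s).
  by split; apply/itvE; [|rewrite sE]; exact: tcauchy_bounds_lt.
have aN : atom0 nu < tcauchy mu1 s < 1 - atomN nu by have := aI; rewrite -nuI => /itvE.
have ne' : atom0 nu < 1 - atomN nu by case/andP: aN; exact: lt_trans.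
have [tau tau0 tauE] := tcauchy_surj nu1 aN.
have := nuE _ (mem_set aI); rewrite -{1}tauE tcauchy_invK// tcauchy_invK//.
rewrite sE tcauchy_invK// mulrCA divff ?mulr1 ?gt_eqF// => tauT.
have := muK s (T / s) s1 t1 sE; rewrite mulrCA divff ?mulr1 ?gt_eqF// => ->.
by rewrite -tauT.
Unshelve. all: by end_near. Qed.
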